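(* Let $\pi$ be a smooth irreducible nonsupercuspidal representation of $G=\mathrm{U}(1,1)(E/F)$ over $\overline{\mathbb{F}}_p$. Then $\pi$ is isomorphic to one and only one of the following: the characters $\omega^k\circ\det$ with $0\le k<q+1$; the twists of the Steinberg representation $(\omega^k\circ\det)\otimes\mathrm{St}_G$ with $0\le k<q+1$; the principal series $\mathrm{ind}_B^G(\mu_\lambda\omega^r)$ with $\lambda\in\overline{\mathbb{F}}_p^\times$, $0\le r<q^2-1$ and $(r,\lambda)\neq((q-1)m,1)$ for all integers $m$.
   Context: $p$ is an odd prime, $F$ a nonarchimedean local field with residue field $\mathbb{F}_q$ of characteristic $p$, uniformizer $\varpi$, and $E$ the unramified quadratic extension of $F$ with nontrivial automorphism $x\mapsto\bar x$; residue fields are identified with subfields of $\overline{\mathbb{F}}_p$. $G=\{g\in\mathrm{GL}_2(E): g^*sg=s\}$, $s=\begin{pmatrix}0&1\\1&0\end{pmatrix}$, $g^*$ conjugate transpose; $B$ is its upper triangular Borel subgroup, $T=\{\mathrm{diag}(a,\bar a^{-1}):a\in E^\times\}\cong E^\times$. $\omega$ is the character of $E^\times$ with $\omega(\varpi)=1$ and $\omega|_{\mathfrak{o}_E^\times}$ the reduction map to $\mathbb{F}_{q^2}^\times\subset\overline{\mathbb{F}}_p^\times$; $\mu_\lambda$ is the unramified character with $\mu_\lambda(\varpi)=\lambda$. Characters of $E^\times$ are viewed as characters of $B$ via $\begin{pmatrix}a&b\\0&\bar a^{-1}\end{pmatrix}\mapsto\chi(a)$. $\det$ maps $G$ into the norm-one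 group $\mathrm{U}(1)(E/F)$. $\mathrm{ind}_B^G$ denotes smooth induction, $\mathrm{St}_G=\mathrm{ind}_B^G(1)/1_G$. All representations are smooth over $\overline{\mathbb{F}}_p$; a representation is supercuspidal if it is not a subquotient of any $\mathrm{ind}_B^G(\chi)$, $\chi$ a smooth character of $B$. *)

(* Defs.v *)
From HB Require Import structures.
From mathcomp Require Import all_boot all_order all_algebra.
Set Implicit Arguments. Unset Strict Implicit. Unset Printing Implicit Defensive.
Import Order.TTheory GRing.Theory Num.Theory.
Local Open Scope ring_scope.

(*  E : the unramified quadratic extension of the nonarchimedean local field *)
(*      F; F is the fixed field of the nontrivial involution cj of E.        *)
(*  v : the normalized discrete valuation of E (value on 0 irrelevant).      *)
(*  unif : a uniformizer varpi of F (cj-fixed, v varpi = 1); since F's       *)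
(*      uniformizer is a uniformizer of E, E/F is unramified.               *)
(*  C : the coefficient field  \bar F_p  (algebraically closed, char p,      *)
(*      algebraic over F_p).                                                 *)
(*  red : the reduction map o_E -> k_E, with k_E identified with a subfield  *)
(*      (of order q^2) of C.                                                 *)
Record LFData (p q : nat) (E : fieldType) (C : closedFieldType) := {
  cj : {rmorphism E -> E};
  cj_invol : involutive cj;
  cj_nontriv : exists x : E, cj x != x;
  v : E -> int;
  v_mul : forall x y, x != 0 -> y != 0 -> v (x * y) = v x + v y;
  v_add : forall x y, x != 0 -> y != 0 -> x + y != 0 ->
            Num.min (v x) (v y) <= v (x + y);
  v_cj : forall x, x != 0 -> v (cj x) = v x;
  unif : E;
  unif_neq0 : unif != 0;
  unif_v : v unif = 1;
  unif_cj : cj unif = unif;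
  complete : forall a : nat -> E,
     (forall N : int, exists M : nat, forall m n : nat, (M <= m)%N -> (M <= n)%N ->
        a m - a n = 0 \/ N <= v (a m - a n)) ->
     exists l : E, forall N : int, exists M : nat, forall m : nat, (M <= m)%N ->
        a m - l = 0 \/ N <= v (a m - l);
  red : E -> C;
  red_add : forall x y, (x == 0) || (0 <= v x) -> (y == 0) || (0 <= v y) ->
              red (x + y) = red x + red y;
  red_mul : forall x y, (x == 0) || (0 <= v x) -> (y == 0) || (0 <= v y) ->
              red (x * y) = red x * red y;
  red_one : red 1 = 1;
  red_ker : forall x, (x == 0) || (0 <= v x) ->
              (red x == 0) = ((x == 0) || (0 < v x));
  residue_card : exists s : seq C, [/\ uniq s, size s = (q ^ 2)%N &
              forall c, c \in s <-> exists x, ((x == 0) || (0 <= v x)) /\ red x = c];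
  p_prime : prime p;
  p_odd : odd p;
  p_char : p \in [pchar C];
  C_algebraic : forall c : C, exists n : nat, (0 < n)%N /\ c ^+ (p ^ n) = c
}.

Section Defs.
Variables (p q : nat) (E : fieldType) (C : closedFieldType) (D : LFData p q E C).

Definition inO (x : E) : bool := (x == 0) || (0 <= v D x).

Definition ctr (g : 'M[E]_2) : 'M[E]_2 := (map_mx (cj D) g)^T.
Definition smx : 'M[E]_2 := \matrix_(i, j) (i != j)%:R.
Definition inG (g : 'M[E]_2) : bool := ctr g *m smx *m g == smx.
Definition inB (g : 'M[E]_2) : bool := inG g && (g 1 0 == 0).
(* principal congruence subgroups K_n = G cap (1 + varpi^n M_2(o_E)),
   a basis of neighbourhoods of 1 in G *)
Definition inK (n : nat) (g : 'M[E]_2) : bool :=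
  inG g && [forall i, [forall j, inO ((g - 1) i j / unif D ^+ n)]].

(* omega: omega(varpi) = 1, omega|o_E^x = reduction;  mu_lambda unramified *)
Definition omega (x : E) : C := red D (x * unif D ^ (- v D x)).
Definition mu (lam : C) (x : E) : C := lam ^ (v D x).

Definition IsSmoothRep (V : lmodType C) (rho : 'M[E]_2 -> V -> V) : Prop :=
  [/\ forall g, inG g -> forall (a : C) (x y : V), rho g (a *: x + y) = a *: rho g x + rho g y,
      forall x, rho 1 x = x,
      forall g h x, inG g -> inG h -> rho (g *m h) x = rho g (rho h x) &
      forall x, exists n, forall g, inK n g -> rho g x = x].

Definition Subspace (V : lmodType C) (P : V -> Prop) : Prop :=
  P 0 /\ forall (a : C) x y, P x -> P y -> P (a *: x + y).

Definition Irreducible (V : lmodType C) (rho : 'M[E]_2 -> V -> V) : Prop :=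
  (exists x : V, x != 0) /\
  forall P : V -> Prop, Subspace P -> (forall g x, inG g -> P x -> P (rho g x)) ->
     (forall x, P x -> x = 0) \/ (forall x, P x).

(* functions on G (extended by 0 outside G), right translation *)
Definition Fun := 'M[E]_2 -> C.
Definition lcomb (a : C) (f h : Fun) : Fun := fun g => a * f g + h g.
Definition rt (h : 'M[E]_2) (f : Fun) : Fun := fun g => f (g *m h).
Definition FSubspace (P : Fun -> Prop) : Prop :=
  P (fun _ => 0) /\ forall a f h, P f -> P h -> P (lcomb a f h).

Definition SmoothCharB (chi : 'M[E]_2 -> C) : Prop :=
  [/\ forall b, inB b -> chi b != 0,
      forall b b', inB b -> inB b' -> chi (b *m b') = chi b * chi b' &
      exists n, forall b, inB b -> inK n b -> chi b = 1].

Definition IndSpace (chi : 'M[E]_2 -> C) (f : Fun) : Prop :=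
  [/\ forall g, ~~ inG g -> f g = 0,
      forall b g, inB b -> inG g -> f (b *m g) = chi b * f g &
      exists n, forall g k, inG g -> inK n k -> f (g *m k) = f g].

Definition SubquotInd (V : lmodType C) (rho : 'M[E]_2 -> V -> V) (chi : 'M[E]_2 -> C) : Prop :=
  exists (P : Fun -> Prop) (F : Fun -> V),
    [/\ forall f, P f -> IndSpace chi f,
        FSubspace P &
        forall h f, inG h -> P f -> P (rt h f)] /\
    [/\
        forall a f f', P f -> P f' -> F (lcomb a f f') = a *: F f + F f',
        forall h f, inG h -> P f -> F (rt h f) = rho h (F f) &
        forall x, exists f, P f /\ F f = x].

Definition Supercuspidal (V : lmodType C) (rho : 'M[E]_2 -> V -> V) : Prop :=
  ~ exists chi, SmoothCharB chi /\ SubquotInd rho chi.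

Definition IsoChar (V : lmodType C) (rho : 'M[E]_2 -> V -> V) (psi : 'M[E]_2 -> C) : Prop :=
  exists x : V, [/\ x != 0, forall y, exists c : C, y = c *: x &
                    forall g, inG g -> rho g x = psi g *: x].

(* pi isomorphic to psi (x) St_G, St_G = ind_B^G(1) / 1_G *)
Definition IsoTwistSt (V : lmodType C) (rho : 'M[E]_2 -> V -> V) (psi : 'M[E]_2 -> C) : Prop :=
  exists F : Fun -> V,
    [/\ forall a f f', IndSpace (fun _ => 1) f -> IndSpace (fun _ => 1) f' ->
           F (lcomb a f f') = a *: F f + F f',
        forall x, exists f, IndSpace (fun _ => 1) f /\ F f = x,
        forall f, IndSpace (fun _ => 1) f ->
           (F f = 0 <-> exists c : C, forall g, inG g -> f g = c) &
        forall h f, inG h -> IndSpace (fun _ => 1) f -> psi h *: F (rt h f) = rho h (F f)].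

Definition IsoInd (V : lmodType C) (rho : 'M[E]_2 -> V -> V) (chi : 'M[E]_2 -> C) : Prop :=
  exists F : Fun -> V,
    [/\ forall a f f', IndSpace chi f -> IndSpace chi f' ->
           F (lcomb a f f') = a *: F f + F f',
        forall f f', IndSpace chi f -> IndSpace chi f' -> F f = F f' -> f = f',
        forall x, exists f, IndSpace chi f /\ F f = x &
        forall h f, inG h -> IndSpace chi f -> F (rt h f) = rho h (F f)].

Inductive Param :=
| PChar of nat
| PSt of nat
| PPS of C & nat.

Definition ValidParam (prm : Param) : Prop :=
  match prm with
  | PChar k => (k < q.+1)%N
  | PSt k => (k < q.+1)%N
  | PPS lam r => [/\ lam != 0, (r < q ^ 2 - 1)%N &
                    ~ (exists m : int, r%:Z = (q%:Z - 1) * m /\ lam = 1)]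
  end.

Definition IsoParam (V : lmodType C) (rho : 'M[E]_2 -> V -> V) (prm : Param) : Prop :=
  match prm with
  | PChar k => IsoChar rho (fun g => omega (\det g) ^+ k)
  | PSt k => IsoTwistSt rho (fun g => omega (\det g) ^+ k)
  | PPS lam r => IsoInd rho (fun b => mu lam (b 0 0) * omega (b 0 0) ^+ r)
  end.

End Defs.

(* Main.v *)
Require Import Defs.
From HB Require Import structures.
From mathcomp Require Import all_boot all_order all_algebra.
From mathcomp Require Import cyclic boolp zify ring.
Set Implicit Arguments. Unset Strict Implicit. Unset Printing Implicit Defensive.
Import Order.TTheory GRing.Theory Num.Theory.
Local Open Scope ring_scope.

(* Let [W] be the subspace [f 1 = 0] of [ind_B^G chi]. By the Bruhat decomposition its
   elements are the compactly supported locally constant functions on the unipotent radical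
   [N], and [W] is already irreducible under [B], because the p-group [N] has nonzero fixed
   vectors in characteristic p. Hence a proper nonzero G-stable subspace of [ind_B^G chi] meets
   [W] trivially and is a line on which [G] acts by a character extending [chi]; the relation
   [tmat b *m s = nmat b *m nbar (- b^-1) *m nmat b] then forces [chi] to be trivial on [F^x], that is
   [chi = omega^((q-1)m)], the restriction of a power of [omega o det]. This gives the list.

   Conversely, [N] acts trivially on characters but not on [W]; as a B-module a twist of
   Steinberg is irreducible, a principal series is an extension of [chi] by [W], and [chi] can
   be read off this extension; the twist of Steinberg is read off the action of the torus on the
   line of vectors fixed by the pro-p Iwahori subgroup. *)

(** * Valuation *)

(** Everything is computed in the coordinates [f 1] and [x |-> f (sn x)], with x of trace zero,
    which determine an element of the induced space. Fixed vectors of N come from difference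
    operators: in characteristic p, (t_y - 1)^(p^e) = t_(p^e y) - 1 for the translation t_y, and p^e
    y becomes arbitrarily small, so t_y - 1 is nilpotent on a locally constant function. The number
    q enters only through the cardinality q^2 of the residue field, so the fact that conjugation
    reduces to the q-power map has to be proved ([red_cj]). It governs the exceptional exponents:
    the determinant of [tmat a] is a / cj a, hence omega o det restricts to omega^(1-q) on the
    torus, and the values of omega are roots of unity of order dividing q^2 - 1. For uniqueness, W
    has to be recognized inside an abstract V. It is generated under B by one vector of the form n w
    - w with n in N, and every vector n g - g lies in W because N acts trivially on the quotient by
    W. So W in one model is carried into W in the other ([model_subset]). *)

Section Valuation.
Variables (p q : nat) (E : fieldType) (C : closedFieldType) (D : LFData p q E C).
Local Notation v := (v D).
Local Notation unif := (unif D).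
Local Notation cj := (cj D).
Local Notation red := (red D).

(** The fractional ideal [unif ^ j] o_E. The clause for 0 stands for v 0 = +oo, the value of [v] at
    0 being arbitrary. *)
Definition val_ge (j : int) (x : E) : bool := (x == 0) || (j <= v x).
Local Notation bd := val_ge.

Lemma bd0 j : bd j 0.
Proof. by rewrite /val_ge eqxx. Qed.

Lemma bd_neq0 j x : x != 0 -> bd j x = (j <= v x).
Proof. by rewrite /val_ge => /negPf->. Qed.

Lemma v1 : v 1 = 0.
Proof.
have := v_mul D (oner_neq0 E) (oner_neq0 E); rewrite mulr1 => /eqP.
by rewrite -subr_eq0 opprD addrA subrr sub0r oppr_eq0 => /eqP.
Qed.

Lemma vN x : v (- x) = v x.
Proof.
have [->|x0] := eqVneq x 0; first by rewrite oppr0.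
have n10 : (-1 : E) != 0 by rewrite oppr_eq0 oner_eq0.
have h : v (-1) = 0.
  have := v_mul D n10 n10; rewrite mulrNN mulr1 v1; lia.
by rewrite -mulN1r v_mul // h add0r.
Qed.

Lemma vV x : x != 0 -> v x^-1 = - v x.
Proof.
move=> x0; have := v_mul D x0 (invr_neq0 x0); rewrite divff // v1; lia.
Qed.

Lemma vX x n : x != 0 -> v (x ^+ n) = n%:Z * v x.
Proof.
move=> x0; elim: n => [|n IH]; first by rewrite expr0 v1 mul0r.
rewrite exprS v_mul // ?expf_neq0 // IH; lia.
Qed.

Lemma vXz x (z : int) : x != 0 -> v (x ^ z) = z * v x.
Proof.
move=> x0; case: z => n; first by rewrite -exprnP vX.
rewrite NegzE -invr_expz vV ?expfz_neq0 // -exprnP vX //; lia.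
Qed.

Lemma v_unifX (z : int) : v (unif ^ z) = z.
Proof. by rewrite vXz ?unif_neq0 // unif_v mulr1. Qed.

Lemma unifX_neq0 (z : int) : unif ^ z != 0.
Proof. by rewrite expfz_neq0 // unif_neq0. Qed.

Lemma v_cj' x : v (cj x) = v x.
Proof. by have [->|x0] := eqVneq x 0; [rewrite rmorph0 | exact: v_cj]. Qed.

Lemma bdD j x y : bd j x -> bd j y -> bd j (x + y).
Proof.
rewrite /val_ge; have [->|x0] := eqVneq x 0; first by rewrite add0r.
have [->|y0] := eqVneq y 0; first by rewrite addr0 (negPf x0).
have [//|s0] := eqVneq (x + y) 0; move=> /= hx hy.
by apply: le_trans (v_add D x0 y0 s0); rewrite le_min hx hy.
Qed.

Lemma bdN j x : bd j (- x) = bd j x.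
Proof. by rewrite /val_ge oppr_eq0 vN. Qed.

Lemma bdB j x y : bd j x -> bd j y -> bd j (x - y).
Proof. by move=> hx hy; apply: bdD => //; rewrite bdN. Qed.

Lemma bdM i j x y : bd i x -> bd j y -> bd (i + j) (x * y).
Proof.
rewrite /val_ge mulf_eq0; have [//|x0] := eqVneq x 0.
have [//|y0] := eqVneq y 0; move=> /= hx hy.
by rewrite v_mul // lerD.
Qed.

Lemma bdM0 j x y : bd 0 x -> bd j y -> bd j (x * y).
Proof. by move=> hx hy; rewrite -[j]add0r; apply: bdM. Qed.

Lemma bd_le i j x : i <= j -> bd j x -> bd i x.
Proof. by rewrite /val_ge => ij /orP[->//|h]; rewrite (le_trans ij h) orbT. Qed.

Lemma bd_cj j x : bd j (cj x) = bd j x.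
Proof. by rewrite /val_ge fmorph_eq0 v_cj'. Qed.

Lemma bd1 : bd 0 1.
Proof. by rewrite /val_ge v1 lexx orbT. Qed.

Lemma bdX x n : bd 0 x -> bd 0 (x ^+ n).
Proof.
by move=> hx; elim: n => [|n IH]; rewrite ?bd1 // exprS bdM0.
Qed.

Lemma bd_nat n : bd 0 n%:R.
Proof. by elim: n => [|n IH]; rewrite ?bd0 // -natr1 bdD // bd1. Qed.

Lemma bd_divX (i j : int) x : bd i (x / unif ^ j) = bd (i + j) x.
Proof.
rewrite /val_ge mulf_eq0 invr_eq0 (negPf (unifX_neq0 j)) orbF.
have [//|x0] := eqVneq x 0.
by rewrite v_mul ?invr_neq0 ?unifX_neq0 // vV ?unifX_neq0 // v_unifX /=; lia.
Qed.

Lemma inO_bd x : inO D x = bd 0 x.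
Proof. by []. Qed.

Lemma inO_divX n x : inO D (x / unif ^+ n) = bd n x.
Proof. by rewrite inO_bd (_ : unif ^+ n = unif ^ n%:Z) // bd_divX add0r. Qed.

(** If x were in the maximal ideal, so would be 1 = x - (x - 1). *)
Lemma bd1_unit x : bd 1 (x - 1) -> x != 0 /\ v x = 0.
Proof.
move=> h; have x0 : x != 0.
  apply: contraTneq h => ->; rewrite sub0r bdN /val_ge oner_eq0 v1 //.
split=> //; have hx : bd 0 x.
  by rewrite -[x](subrK 1) bdD ?bd1 // (bd_le _ h).
case: (ltrgtP (v x) 0) => // hv; first by move: hx; rewrite bd_neq0 // leNgt hv.
have : bd 1 1.
  have -> : 1 = x - (x - 1) :> E by rewrite subKr.
  apply: bdB => //; rewrite bd_neq0 //; lia.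
by rewrite /val_ge oner_eq0 v1.
Qed.

Lemma red0 : red 0 = 0.
Proof. by apply/eqP; rewrite red_ker ?eqxx. Qed.

Lemma redD x y : bd 0 x -> bd 0 y -> red (x + y) = red x + red y.
Proof. exact: red_add. Qed.

Lemma redM x y : bd 0 x -> bd 0 y -> red (x * y) = red x * red y.
Proof. exact: red_mul. Qed.

Lemma redN x : bd 0 x -> red (- x) = - red x.
Proof.
by move=> hx; apply/eqP; rewrite -subr_eq0 opprK -redD ?bdN // addNr red0.
Qed.

Lemma redB x y : bd 0 x -> bd 0 y -> red (x - y) = red x - red y.
Proof. by move=> hx hy; rewrite redD ?bdN // redN. Qed.

Lemma red_eq0 x : bd 0 x -> (red x == 0) = bd 1 x.
Proof. by move=> hx; rewrite red_ker. Qed.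

Lemma red_eq x y : bd 0 x -> bd 0 y -> (red x == red y) = bd 1 (x - y).
Proof. by move=> hx hy; rewrite -subr_eq0 -redB // red_eq0 // bdB. Qed.

Lemma redX x n : bd 0 x -> red (x ^+ n) = red x ^+ n.
Proof.
move=> hx; elim: n => [|n IH]; first by rewrite red_one.
by rewrite !exprS redM ?IH // bdX.
Qed.

Lemma red_nat n : red n%:R = n%:R.
Proof.
elim: n => [|n IH]; first by rewrite red0.
by rewrite -!natr1 redD ?bd_nat ?bd1 // IH red_one.
Qed.

Lemma red_neq0 x : x != 0 -> v x = 0 -> red x != 0.
Proof. by move=> x0 vx; rewrite red_eq0 bd_neq0 // vx. Qed.

Lemma redV x : x != 0 -> v x = 0 -> red x^-1 = (red x)^-1.
Proof.
move=> x0 vx; apply: (mulfI (red_neq0 x0 vx)).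
rewrite divff ?red_neq0 // -redM ?divff ?red_one //.
  by rewrite bd_neq0 // vx.
by rewrite bd_neq0 ?invr_neq0 // vV // vx.
Qed.

Lemma bd_p : bd 1 p%:R.
Proof.
by rewrite -red_eq0 ?bd_nat // red_nat (pcharf0 (p_char D)).
Qed.

Lemma bd_pX n : bd n%:Z ((p ^ n)%:R).
Proof.
elim: n => [|n IH]; first by rewrite bd1.
by rewrite expnS natrM (_ : n.+1%:Z = 1 + n%:Z) ?bdM ?bd_p //; lia.
Qed.

(** In y^p - 1 = (y - 1)(1 + y + ... + y^(p-1)) the second factor reduces to p = 0, because y
    reduces to 1; so each p-th power gains a level. *)
Lemma bd_expp (x : E) n : bd 1 (x - 1) -> bd (n.+1)%:Z (x ^+ (p ^ n) - 1).
Proof.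
move=> hx; elim: n => [|n IH]; first by rewrite expr1.
rewrite expnSr exprM; set y := x ^+ _ in IH *.
have hy1 : bd 1 (y - 1) by apply: bd_le IH; lia.
have [y0 vy] := bd1_unit hy1.
have hy0 : bd 0 y by rewrite bd_neq0 // vy.
rewrite subrX1 (_ : n.+2%:Z = n.+1%:Z + 1); last by lia.
apply: bdM => //.
have ry : red y = 1 by apply/eqP; rewrite -(red_one D) red_eq // bd1.
have hs m : bd 0 (\sum_(i < m) y ^+ i) /\ red (\sum_(i < m) y ^+ i) = m%:R.
  elim: m => [|m [IH1 IH2]]; first by rewrite big_ord0 red0 bd0.
  have hm : bd 0 (y ^+ m) by exact: bdX.
  rewrite big_ord_recr /=; split; first exact: bdD.
  by rewrite redD // IH2 redX // ry expr1n natr1.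
by rewrite -red_eq0; case: (hs p) => // _ ->; rewrite (pcharf0 (p_char D)).
Qed.

(** Frobenius is injective: c^p - 1 = (c - 1)^p. *)
Lemma pchar_expX1 (c : C) n : c ^+ (p ^ n) = 1 -> c = 1.
Proof.
elim: n => [|n IH]; first by rewrite expr1.
rewrite expnSr exprM => h; apply: IH; apply/eqP; rewrite -subr_eq0.
have := pFrobenius_autB_comm (p_char D) (commr1 (c ^+ (p ^ n))).
rewrite !pFrobenius_autE h expr1n subrr => /eqP.
by rewrite expf_eq0 => /andP[_ ->].
Qed.

(** Rescale x - cj x by a power of [unif], which conjugation fixes. Such a unit gives o_E = o_F + u
    o_F below. *)
Lemma exists_skew_unit : exists u : E, [/\ u != 0, v u = 0 & cj u = - u].
Proof.
have [x hx] := cj_nontriv D.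
pose y := x - cj x.
have y0 : y != 0 by rewrite subr_eq0 eq_sym.
exists (y * unif ^ (- v y)); split.
- by rewrite mulf_neq0 // unifX_neq0.
- by rewrite v_mul ?unifX_neq0 // v_unifX subrr.
by rewrite rmorphM fmorphXz /= unif_cj /y rmorphB /= cj_invol -mulNr opprB.
Qed.

Lemma C_two_neq0 : (2%:R : C) != 0.
Proof.
rewrite -(dvdn_pcharf (p_char D)); apply/negP => /(dvdn_leq (ltn0Sn 1)).
by have := p_odd D; have := prime_gt1 (p_prime D); case: p => [|[|[|n]]].
Qed.

End Valuation.

(** * Finite fields and the residue field *)

Section FiniteSubfields.
Variables (F : fieldType) (s : seq F).
Hypotheses (s_uniq : uniq s) (s_0 : 0 \in s)
  (s_mul : forall x y, x \in s -> y \in s -> x * y \in s).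

(** Multiplication by x permutes the nonzero elements, hence preserves their product. *)
Lemma finite_fermat x : x \in s -> x != 0 -> x ^+ (size s).-1 = 1.
Proof.
move=> xs x0; pose t : seq F := rem 0 s.
have tE y : (y \in t) = (y != 0) && (y \in s) by rewrite mem_rem_uniq // inE.
have t_uniq : uniq t by rewrite rem_uniq.
have sz_t : size t = (size s).-1 by rewrite size_rem.
have mt_uniq : uniq (map ( *%R x) t) by rewrite map_inj_uniq //; apply: mulfI.
have sub : {subset map ( *%R x) t <= t}.
  move=> _ /mapP[y yt ->]; move: yt; rewrite !tE => /andP[y0 ys].
  by rewrite mulf_neq0 // s_mul.
have [] := uniq_min_size mt_uniq sub; first by rewrite size_map.
move=> _ /(uniq_perm mt_uniq t_uniq) pe.
have : \prod_(y <- map ( *%R x) t) y = \prod_(y <- t) y by exact: perm_big.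
rewrite big_map big_split /= big_const_seq count_predT iter_mulr_1 sz_t.
move=> e; have t0 : \prod_(y <- t) y != 0.
  by rewrite prodf_seq_neq0; apply/allP => y; rewrite tE /= => /andP[].
by apply: (mulIf t0); rewrite e mul1r.
Qed.

Lemma finite_fermat_id x : x \in s -> x ^+ size s = x.
Proof.
move=> xs; have [->|x0] := eqVneq x 0.
  by rewrite expr0n; move: s_0; case: s.
have : (0 < size s)%N by move: s_0; case: s.
by move=> /prednK <-; rewrite exprS finite_fermat // mulr1.
Qed.

Lemma finite_prim_root : (1 < size s)%N ->
  exists2 z, z \in s & (size s).-1.-primitive_root z.
Proof.
move=> s1; have n0 : (0 < (size s).-1)%N by lia.
have r1 : all (size s).-1.-unity_root (rem 0 s).
  apply/allP => y; rewrite mem_rem_uniq // inE => /andP[y0 ys].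
  by apply/unity_rootP; apply: finite_fermat.
have := has_prim_root n0 r1 (rem_uniq _ s_uniq).
rewrite size_rem // leqnn => /(_ isT) /hasP[z zs hz].
by exists z => //; apply: (mem_rem zs).
Qed.

(* The polynomial ('X + y)^q - 'X^q - y has degree < q and q roots. *)
Lemma finite_frobeniusD : (forall x y, x \in s -> y \in s -> x + y \in s) ->
  forall x y, y \in s -> (x + y) ^+ size s = x ^+ size s + y.
Proof.
move=> s_add x y ys; set n := size s.
have n0 : (0 < n)%N by rewrite /n; move: s_0; case: s.
pose P : {poly F} := ('X + y%:P) ^+ n - 'X^n - y%:P.
have szP : (size P <= n)%N.
  apply/leq_sizeP => j nj.
  rewrite /P exprDn big_ord_recl /= subn0 expr0 mulr1 bin0 mulr1n [_ - 'X^n]addrAC subrr.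
  rewrite add0r coefB coefC (gtn_eqF (leq_trans n0 nj)) subr0 coef_sum.
  apply: big1 => i _; rewrite coefMn -rmorphXn /= coefMC coefXn /bump /=.
  have -> : (j == n - (1 + i))%N = false by have := ltn_ord i; lia.
  by rewrite mul0r mul0rn.
have P0 : P = 0.
  apply/eqP; apply: contraTT szP => P0; rewrite -ltnNge.
  apply: max_poly_roots => //; apply/allP => a as_.
  rewrite /root /P !hornerE !finite_fermat_id ?s_add //.
  by rewrite [a + y]addrC addrK subrr.
have := congr1 (horner^~ x) P0; rewrite /P !hornerE => /eqP.
by rewrite -addrA -opprD subr_eq0 => /eqP.
Qed.

End FiniteSubfields.

Section ResidueField.
Variables (p q : nat) (E : fieldType) (C : closedFieldType) (D : LFData p q E C).
Local Notation v := (v D).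
Local Notation cj := (cj D).
Local Notation red := (red D).
Local Notation bd := (val_ge D).

Lemma residue_seq : exists s : seq C, [/\ uniq s, size s = (q ^ 2)%N,
  forall x, bd 0 x -> red x \in s &
  forall c, c \in s -> exists2 x, bd 0 x & red x = c].
Proof.
have [s [s1 s2 s3]] := residue_card D; exists s; split=> //.
  by move=> x hx; apply/s3; exists x.
by move=> c /s3[x [h1 h2]]; exists x.
Qed.

Lemma half_facts : [/\ (2%:R : E) != 0, v 2%:R = 0 & bd 0 (2%:R^-1 : E)].
Proof.
have n2 : ~~ bd 1 (2%:R : E).
  by rewrite -red_eq0 ?bd_nat // red_nat (C_two_neq0 D).
have n0 : (2%:R : E) != 0 by apply: contraNneq n2 => ->; rewrite bd0.
have v2 : v 2%:R = 0.
  by move: n2 (bd_nat D 2); rewrite !bd_neq0 //; lia.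
by split=> //; rewrite bd_neq0 ?invr_neq0 // vV // v2.
Qed.

(** Half the sum and half the difference of x and cj x; they stay integral because p is odd. *)
Lemma fixed_split (u x : E) : u != 0 -> v u = 0 -> cj u = - u -> bd 0 x ->
  exists a b, [/\ bd 0 a, bd 0 b, cj a = a, cj b = b & x = a + u * b].
Proof.
move=> u0 vu cu hx; have [n2 v2 h2] := half_facts.
have hc : bd 0 (cj x) by rewrite bd_cj.
have hu : bd 0 u^-1 by rewrite bd_neq0 ?invr_neq0 // vV // vu.
exists ((x + cj x) * 2%:R^-1), (u^-1 * ((x - cj x) * 2%:R^-1)).
have c2 : cj (2%:R^-1) = 2%:R^-1 by rewrite fmorphV rmorph_nat.
split.
- by rewrite mulrC bdM0 // bdD.
- by rewrite bdM0 // mulrC bdM0 // bdB.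
- by rewrite rmorphM rmorphD /= cj_invol c2 [cj x + x]addrC.
- rewrite !rmorphM rmorphB fmorphV /= cj_invol c2 cu; field.
  by rewrite n2 u0 oppr_eq0 u0.
- rewrite mulVKf // -mulrDl addrACA subrr addr0 -mulr2n -[x *+ 2]mulr_natr.
  by rewrite mulfK.
Qed.

(** Conjugation preserves the valuation, so a - u b lies in the maximal ideal together with a + u
    b. *)
Lemma fixed_split_inj (u a b : E) : u != 0 -> v u = 0 -> cj u = - u ->
  bd 0 a -> bd 0 b -> cj a = a -> cj b = b ->
  red (a + u * b) = 0 -> red a = 0 /\ red b = 0.
Proof.
move=> u0 vu cu ha hb ca cb; have [n2 v2 h2] := half_facts.
have hu : bd 0 u by rewrite bd_neq0 // vu.
have hu' : bd 0 u^-1 by rewrite bd_neq0 ?invr_neq0 // vV // vu.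
move=> /eqP; rewrite red_eq0; last by rewrite bdD // bdM0.
move=> h.
have h' : bd 1 (a - u * b).
  by rewrite -bd_cj rmorphB rmorphM /= ca cb cu mulNr opprK.
split; apply/eqP; rewrite red_eq0 //.
  rewrite -[a](mulKf n2) bdM0 //.
  have -> : 2%:R * a = (a + u * b) + (a - u * b) by ring.
  exact: bdD.
rewrite -[b](mulKf u0) -[u * b](mulKf n2); do 2!apply: bdM0 => //.
have -> : 2%:R * (u * b) = (a + u * b) - (a - u * b) by ring.
exact: bdB.
Qed.

Lemma q_gt1 : (1 < q)%N.
Proof.
have [s [s1 s2 s3 _]] := residue_seq.
have : (1 < size s)%N.
  have := @uniq_leq_size _ [:: 0; 1] s; rewrite /= inE eq_sym oner_eq0; apply=> //.
  move=> x; rewrite !inE => /orP[] /eqP->.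
    by rewrite -(red0 D) s3 // bd0.
  by rewrite -(red_one D) s3 // bd1.
by rewrite s2; case: q => [|[|n]].
Qed.

Lemma residue_gen : exists z : E, [/\ z != 0, v z = 0,
  (q ^ 2).-1.-primitive_root (red z) &
  forall x, x != 0 -> v x = 0 -> exists i, red x = red z ^+ i].
Proof.
have [s [s1 s2 s3 s4]] := residue_seq.
have s_mul x y : x \in s -> y \in s -> x * y \in s.
  move=> /s4[a ha <-] /s4[b hb <-]; rewrite -redM //; apply: s3; exact: bdM0.
have s0 : 0 \in s by rewrite -(red0 D) s3 // bd0.
have [|c cs] := finite_prim_root s1 s0 s_mul.
  by rewrite s2; have := q_gt1; case: q => [|[|n]].
rewrite s2 => pc; have [z hz ez] := s4 _ cs.
have [n0 nE] : (0 < (q ^ 2).-1)%N /\ ((size s).-1 = (q ^ 2).-1)%N.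
  by rewrite s2; split=> //; apply: (prim_order_gt0 pc).
have c0 : c != 0.
  apply/eqP => c0; have := prim_expr_order pc; rewrite c0 expr0n.
  by case: (_.-1) n0 => // m _ /eqP; rewrite eq_sym oner_eq0.
have z0 : z != 0 by apply: contraNneq c0 => z0; rewrite -ez z0 red0.
have vz : v z = 0.
  have := red_eq0 hz; rewrite ez (negPf c0) !bd_neq0 // in hz * => /esym; lia.
exists z; split=> //; first by rewrite ez.
move=> x x0 vx; have hx : bd 0 x by rewrite bd_neq0 // vx.
have := finite_fermat s1 s0 s_mul (s3 _ hx) (red_neq0 x0 vx).
by rewrite nE => /(prim_rootP pc)[i ->]; exists i; rewrite ez.
Qed.

(** Let t be the set of reductions of conjugation-fixed integers and m = red u. The residue field is
    t + m t, a direct sum, so t has q elements and is fixed by the q-power map. It remains to see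
    that m^q = - m, which is the reduction of cj u. *)
Lemma red_cj x : bd 0 x -> red (cj x) = red x ^+ q.
Proof.
have [s [s1 s2 s3 s4]] := residue_seq.
have [u [u0 vu cu]] := exists_skew_unit D.
pose t := [seq c <- s | `[< exists x, [/\ bd 0 x, cj x = x & red x = c] >]].
have tP c : c \in t <-> exists x, [/\ bd 0 x, cj x = x & red x = c].
  rewrite mem_filter; split=> [/andP[/asboolP]//|h].
  apply/andP; split; first exact/asboolP.
  by case: h => y [hy _ <-]; exact: s3.
have t_uniq : uniq t by rewrite filter_uniq.
have t0 : 0 \in t.
  by apply/tP; exists 0; rewrite bd0 rmorph0 red0.
have t_mul a b : a \in t -> b \in t -> a * b \in t.
  move=> /tP[y [hy cy <-]] /tP[w [hw cw <-]]; apply/tP; exists (y * w).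
  by rewrite bdM0 // rmorphM /= cy cw redM.
have t_add a b : a \in t -> b \in t -> a + b \in t.
  move=> /tP[y [hy cy <-]] /tP[w [hw cw <-]]; apply/tP; exists (y + w).
  by rewrite bdD // rmorphD /= cy cw redD.
have hu : bd 0 u by rewrite bd_neq0 // vu.
set m := red u; have m0 : m != 0 by exact: red_neq0.
pose r := [seq a + m * b | a <- t, b <- t].
have r_uniq : uniq r.
  apply: allpairs_uniq => // -[a b] [a' b'].
  move=> /allpairsP[[? ?] /= [ha hb [-> ->]]] {a b}.
  move=> /allpairsP[[? ?] /= [ha' hb' [-> ->]]] {a' b'}.
  move: ha hb ha' hb' => /tP[a [ha ca <-]] /tP[b [hb cb <-]].
  move=> /tP[a' [ha' ca' <-]] /tP[b' [hb' cb' <-]] e.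
  have [] := @fixed_split_inj u (a - a') (b - b') u0 vu cu; rewrite ?bdB //.
  - by rewrite rmorphB /= ca ca'.
  - by rewrite rmorphB /= cb cb'.
  - rewrite redD ?bdM0 ?bdB // redM ?bdB // !redB //.
    apply/eqP; rewrite mulrBr addrACA -opprD subr_eq0; exact/eqP.
  by rewrite !redB // => /subr0_eq -> /subr0_eq ->.
have r_s : r =i s.
  move=> c; apply/allpairsP/idP => [[[? ?] /= [/tP[a [ha ca <-]] /tP[b [hb cb <-]] ->]]|].
    by rewrite -redM // -redD ?bdM0 //; apply: s3; rewrite bdD ?bdM0.
  move=> /s4[y hy <-]; have [a [b [ha hb ca cb ->]]] := fixed_split u0 vu cu hy.
  exists (red a, red b); split=> /=; [by apply/tP; exists a | by apply/tP; exists b |].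
  by rewrite redD ?bdM0 // redM.
have tq : size t = q.
  have := perm_size (uniq_perm r_uniq s1 r_s); rewrite size_allpairs s2 mulnn.
  by move/eqP; rewrite eqn_exp2r // => /eqP.
(* Otherwise 'X^q - 'X would have q + 1 roots. *)
have fix_root c : c ^+ q = c -> c \in t.
  move=> hc; apply: contraT => ct.
  have sz : size ('X^q - 'X : {poly C}) = q.+1.
    by rewrite size_polyDl size_polyXn // size_polyN size_polyX ltnS q_gt1.
  have : (size (c :: t) < q.+1)%N.
    rewrite -sz; apply: max_poly_roots.
    - by rewrite -size_poly_eq0 sz.
    - rewrite /= /root !hornerE hc subrr eqxx /=.
      apply/allP => y yt; rewrite /root !hornerE -tq finite_fermat_id // subrr //.
    - by rewrite /= ct.
  by rewrite /= tq ltnn.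
(* As m^2 lies in t, m^(q-1) is 1 or -1; the value 1 would put m in t, against the directness of t +
   m t. *)
have mq : m ^+ q = - m.
  have qE : (q = (q.-1).+1)%N by have := q_gt1; lia.
  have m2 : m ^+ 2 \in t.
    apply/tP; exists (u ^+ 2); rewrite bdX // rmorphXn /= cu sqrrN redX //.
  have := finite_fermat t_uniq t0 t_mul m2 (expf_neq0 2 m0).
  rewrite tq -exprM mulnC exprM => /eqP; rewrite sqrf_eq1 => /orP[] /eqP e.
    have /fix_root/tP[a [ha ca ea]] : m ^+ q = m by rewrite qE exprS e mulr1.
    have [] := @fixed_split_inj u (- a) 1 u0 vu cu; rewrite ?bdN ?bd1 //.
    - by rewrite rmorphN /= ca.
    - by rewrite rmorph1.
    - by rewrite mulr1 addrC redB // ea subrr.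
    by move=> _ /eqP; rewrite red_one oner_eq0.
  by rewrite qE exprS e mulrN1.
move=> /(fixed_split u0 vu cu)[a [b [ha hb ca cb ->]]].
have bt : red b \in t by apply/tP; exists b.
have at_ : red a \in t by apply/tP; exists a.
rewrite rmorphD rmorphM /= ca cb cu mulNr.
rewrite redB ?bdM0 // redD ?bdM0 // redM //.
have tE c : c ^+ q = c ^+ size t by rewrite tq.
(* Only the summand [red a] lies in t; [finite_frobeniusD] leaves the other one arbitrary. *)
rewrite addrC [in RHS]addrC tE finite_frobeniusD // exprMn [red b ^+ _]finite_fermat_id //.
by rewrite -tE -/m mq mulNr.
Qed.

End ResidueField.

(** * Locally constant functions on the unipotent radical *)

Section Differences.
Variables (T : zmodType) (F : fieldType) (p : nat).
Hypothesis p_pchar : p \in [pchar F].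

Definition diff (y : T) (f : T -> F) : T -> F := fun x => f (x + y) - f x.

(** Translation by y acts as the variable 'X, and [diff y] as 'X - 1. *)
Lemma iter_diffE y k f x :
  iter k (diff y) f x =
    \sum_(i < k.+1) (('X - 1%:P) ^+ k : {poly F})`_i * f (x + y *+ i).
Proof.
elim: k x => [|k IH] x.
  by rewrite big_ord_recr big_ord0 /= expr0 coef1 eqxx mul1r mulr0n addr0 add0r.
rewrite iterS {1}/diff !IH; set P := ('X - 1%:P) ^+ k.
rewrite exprS -/P mulrBl mul1r.
under [RHS]eq_bigr do rewrite coefB coefXM mulrBl.
rewrite sumrB; congr (_ - _).
  rewrite [RHS]big_ord_recl /= mul0r add0r; apply: eq_bigr => i _.
  by rewrite /bump /= add1n mulrS addrA.
rewrite [RHS]big_ord_recr /= [X in _ + X * _]nth_default ?mul0r ?addr0 //.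
by rewrite size_exp_XsubC.
Qed.

(** In characteristic p, ('X - 1)^(p^e) = 'X^(p^e) - 1. *)
Lemma iter_diff_pX y e f x :
  iter (p ^ e) (diff y) f x = f (x + y *+ (p ^ e)) - f x.
Proof.
have p_gt0 : (0 < p ^ e)%N by rewrite expn_gt0 prime_gt0 // (pcharf_prime p_pchar).
rewrite iter_diffE; set n := (p ^ e)%N in p_gt0 *.
have -> : ('X - 1%:P) ^+ n = 'X^n - 1 :> {poly F}.
  apply/eqP; rewrite -subr_eq opprK -[X in _ + X](expr1n _ n) -exprDn_pchar.
    by rewrite polyC1 subrK.
  rewrite pnatX; apply/orP; left; rewrite pnatE ?(pcharf_prime p_pchar) //.
  by rewrite pchar_poly.
under eq_bigr do rewrite coefB coefXn coef1 mulrBl.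
rewrite sumrB; congr (_ - _).
  rewrite big_ord_recr /= eqxx mul1r big1 ?add0r // => i _.
  by rewrite ltn_eqF ?mul0r.
rewrite big_ord_recl /= mul1r mulr0n addr0 big1 ?addr0 // => i _.
by rewrite mul0r.
Qed.

Lemma iter_diff_invar y k f z :
  (forall x, f (x + z) = f x) ->
  forall x, iter k (diff y) f (x + z) = iter k (diff y) f x.
Proof.
move=> fz; elim: k => [//|k IH] x.
by rewrite iterS {1 3}/diff IH addrAC IH.
Qed.

(** The elements of [l] are treated one at a time: [diff y] is nilpotent on the vector found so far,
    its last nonzero iterate is y-invariant, and, translations commuting, earlier invariances
    survive. *)
Lemma fixed_vector (H : pred T) (Q : (T -> F) -> Prop) (l : seq T) f x0 :
  (forall y g, H y -> Q g -> Q (diff y g)) ->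
  Q f -> f x0 != 0 -> {subset l <= H} ->
  (forall y, y \in l -> exists e, forall x, f (x + y *+ (p ^ e)) = f x) ->
  exists g x1, [/\ Q g, g x1 != 0 & forall y, y \in l -> forall x, g (x + y) = g x].
Proof.
move=> Qd Qf fx0 lH lf.
(* The added clause, that g inherits every invariance of f, makes the hypothesis on p^e y available
   for g in the induction. *)
suff [g [x1 [h1 h2 h3 _]]] : exists g x1, [/\ Q g, g x1 != 0,
    forall y, y \in l -> forall x, g (x + y) = g x &
    forall z, (forall x, f (x + z) = f x) -> forall x, g (x + z) = g x].
  by exists g, x1.
elim: l lH lf => [|y l IH] lH lf; first by exists f, x0.
have [|z zl|g [x1 [Qg gx1 gl gf]]] := IH; first by move=> z zl; apply: lH; rewrite inE zl orbT.
  by apply: lf; rewrite inE zl orbT.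
have yH : H y by apply: lH; rewrite inE eqxx.
have [e fe] := lf y (mem_head _ _).
have ex0 : exists k, `[< forall x, iter k (diff y) g x = 0 >].
  by exists (p ^ e)%N; apply/asboolP => x; rewrite iter_diff_pX (gf _ fe) subrr.
case: (ex_minnP ex0) => -[|k] /asboolP k0 kmin.
  by have /= e0 := k0 x1; rewrite e0 eqxx in gx1.
have [x2 hx2] : exists x, iter k (diff y) g x != 0.
  apply: contrapT => /forallNP h; suff : (k < k)%N by rewrite ltnn.
  apply: kmin; apply/asboolP => x; exact/eqP/negPn/negP/h.
exists (iter k (diff y) g), x2; split=> //.
- by elim: k {k0 kmin hx2} => [//|k IHk]; apply: Qd.
- move=> z; rewrite inE => /orP[/eqP -> x|zl]; last first.
    by apply: iter_diff_invar; exact: gl.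
  by have := k0 x; rewrite iterS /diff => /subr0_eq.
- by move=> z fz; apply: iter_diff_invar; exact: gf.
Qed.

(** Subtracting f y times the indicator of the coset y + L removes this coset from the support. *)
Lemma indicator_span (L : pred T) (Q : (T -> F) -> Prop) (l : seq T) f :
  (forall x y, L x -> L y -> L (x + y)) -> (forall x, L x -> L (- x)) ->
  Q (fun=> 0) -> (forall a g h, Q g -> Q h -> Q (fun x => a * g x + h x)) ->
  (forall y, y \in l -> Q (fun x => (L (x - y))%:R)) ->
  (forall x y, L y -> f (x + y) = f x) ->
  (forall x, f x != 0 -> exists2 y, y \in l & L (x - y)) -> Q f.
Proof.
move=> LD LN Q0 Ql; elim: l f => [|y l IH] f lQ fL fl.
  suff -> : f = fun=> 0 by [].
  apply/funext => x; apply/eqP; apply: contraT => /fl[y]; by rewrite in_nil.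
pose g x := f x - f y * (L (x - y))%:R.
suff Qg : Q g.
  have -> : f = fun x => f y * (L (x - y))%:R + g x.
    by apply/funext => x; rewrite /g addrC subrK.
  by apply: Ql => //; apply: lQ; rewrite mem_head.
apply: IH.
- by move=> z zl; apply: lQ; rewrite inE zl orbT.
- move=> x z Lz; rewrite /g fL //; congr (_ - _ * _%:R); congr nat_of_bool.
  apply/idP/idP => h; last by rewrite addrAC LD.
  by rewrite -[x](addrK z) addrAC LD // LN.
move=> x; rewrite /g; case Lxy : (L (x - y)).
  by rewrite mulr1 -{1}[x](subrK y) [x - y + y]addrC fL // subrr eqxx.
rewrite mulr0 subr0 => /fl[z]; rewrite inE => /orP[/eqP ->|zl Lz].
  by rewrite Lxy.
by exists z.
Qed.

End Differences.

(** * Lattices of trace-zero elements *)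

Section TraceZero.
Variables (p q : nat) (E : fieldType) (C : closedFieldType) (D : LFData p q E C).
Local Notation unif := (unif D).
Local Notation cj := (cj D).
Local Notation red := (red D).
Local Notation bd := (val_ge D).

(** [nmat x] is unitary exactly when cj x = - x, so these lattices are the compact open subgroups of
    N that filter it. *)
Definition trace_zero (n : int) : pred E := fun x => (cj x == - x) && bd n x.
Local Notation trace0 := trace_zero.

Lemma trace0D n x y : trace0 n x -> trace0 n y -> trace0 n (x + y).
Proof.
move=> /andP[/eqP cx bx] /andP[/eqP cy by_].
by rewrite /trace_zero rmorphD /= cx cy opprD eqxx bdD.
Qed.

Lemma trace0N n x : trace0 n x -> trace0 n (- x).
Proof. by rewrite /trace_zero => /andP[/eqP cx bx]; rewrite rmorphN cx eqxx bdN. Qed.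

Lemma trace0B n x y : trace0 n x -> trace0 n y -> trace0 n (x - y).
Proof. by move=> hx hy; rewrite trace0D ?trace0N. Qed.

Lemma trace00 n : trace0 n 0.
Proof. by rewrite /trace_zero rmorph0 oppr0 eqxx bd0. Qed.

Lemma trace0_le m n x : m <= n -> trace0 n x -> trace0 m x.
Proof. by move=> mn /andP[h1 h2]; rewrite /trace_zero h1 (bd_le mn). Qed.

Lemma trace0_pX n x e : trace0 n x -> trace0 (n + e%:Z) (x *+ (p ^ e)).
Proof.
move=> /andP[/eqP cx bx]; rewrite /trace_zero raddfMn /= cx mulNrn eqxx /=.
by rewrite -mulr_natr bdM // bd_pX.
Qed.

(** Two elements agree to the next level when their quotients by [unif ^ b] have the same reduction;
    one representative is kept for each reduction that occurs. *)
Lemma trace0_reps_step (b : int) : exists l : seq E, {subset l <= trace0 b} /\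
  forall x, trace0 b x -> exists2 y, y \in l & trace0 (b + 1) (x - y).
Proof.
have [s [_ _ hs _]] := residue_seq D.
have bd_b x : trace0 b x -> bd 0 (x / unif ^ b).
  by move=> /andP[_ h]; rewrite bd_divX add0r.
suff [l [h1 h2]] : exists l : seq E, {subset l <= trace0 b} /\
    forall x, trace0 b x -> red (x / unif ^ b) \in s ->
      exists2 y, y \in l & red (x / unif ^ b) = red (y / unif ^ b).
  exists l; split=> // x hx; have [|y yl e] := h2 x hx.
    by rewrite hs // bd_b.
  exists y => //; have hy : trace0 b y by exact: h1.
  move/eqP: e; rewrite red_eq ?bd_b // -mulrBl bd_divX addrC => h.
  by rewrite /trace_zero h andbT; case/andP: (trace0B hx hy).
elim: {hs} s => [|c s [l [h1 h2]]]; first by exists [::].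
have [[y [hy ey]]|h] := pselect (exists y, trace0 b y /\ red (y / unif ^ b) = c).
  exists (y :: l); split.
    by move=> x; rewrite inE => /orP[/eqP->//|]; exact: h1.
  move=> x hx; rewrite inE => /orP[/eqP e|hs].
    by exists y; rewrite ?mem_head // e ey.
  by have [w wl e] := h2 x hx hs; exists w; rewrite // inE wl orbT.
exists l; split=> // x hx; rewrite inE => /orP[/eqP e|]; last exact: h2.
by case: h; exists x.
Qed.

Lemma trace0_reps (a : int) (d : nat) : exists l : seq E, {subset l <= trace0 a} /\
  forall x, trace0 a x -> exists2 y, y \in l & trace0 (a + d%:Z) (x - y).
Proof.
elim: d => [|d [l [h1 h2]]].
  exists [:: 0]; split=> [x|x hx]; first by rewrite inE => /eqP->; exact: trace00.
  by exists 0; rewrite ?mem_head // [x - 0]subr0; apply: (trace0_le _ hx); lia.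
have [l' [h1' h2']] := trace0_reps_step (a + d%:Z).
exists [seq y + z | y <- l, z <- l']; split.
  move=> x /allpairsP[[y z] /= [yl zl ->]]; apply: trace0D; first exact: h1.
  by apply: (trace0_le _ (h1' _ zl)); rewrite lerDl.
move=> x hx; have [y yl hy] := h2 x hx; have [z zl hz] := h2' _ hy.
exists (y + z); first by apply/allpairsP; exists (y, z).
by rewrite opprD addrA (_ : a + d.+1%:Z = a + d%:Z + 1) //; lia.
Qed.

(** f lives on the finite quotient of the lattice of level m by a deeper one. Invariance under
    representatives of this quotient is invariance under the whole lattice, and an invariant
    function supported there is a multiple of the indicator. *)
Lemma indicator_of_invariant (m : int) (Q : (E -> C) -> Prop) (n : int) f x0 :
  (forall a g h, Q g -> Q h -> Q (fun x => a * g x + h x)) ->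
  (forall y g, trace0 m y -> Q g -> Q (fun x => g (x + y))) ->
  Q f -> f x0 != 0 -> (forall x, f x != 0 -> trace0 m x) ->
  (forall x y, trace0 n y -> f (x + y) = f x) ->
  Q (fun x => (trace0 m x)%:R).
Proof.
move=> Ql Qt Qf fx0 fm fn.
pose Q' g := Q g /\ forall x, g x != 0 -> trace0 m x.
pose d := `|n - m|%N.
have [l [h1 h2]] := trace0_reps m d.
have md : n <= m + d%:Z by rewrite /d; lia.
pose R g := Q' g /\ forall x y, trace0 n y -> g (x + y) = g x.
have [||||y yl|g [x1 [[[Qg gm] gn] gx1 gl]]] :=
  @fixed_vector E C p (p_char D) (trace0 m) R l f x0.
- move=> y g hy [[Qg gm] gn]; split; last first.
    by move=> x z hz; rewrite /diff [x + z + y]addrAC (gn (x + y) z) // (gn x z).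
  split.
    rewrite /diff; have -> : (fun x => g (x + y) - g x) = fun x => -1 * g x + g (x + y).
      by apply/funext => x; rewrite mulN1r [RHS]addrC.
    by apply: Ql => //; exact: Qt.
  move=> x; apply: contra_neqT => hx; rewrite /diff.
  have -> : g (x + y) = 0.
    apply/eqP; apply: contraNT hx => /gm h.
    by rewrite -[x](addrK y) trace0B.
  by rewrite (_ : g x = 0) ?subrr //; apply/eqP; apply: contraNT hx => /gm.
- by [].
- by [].
- by [].
(* p lies in the maximal ideal, so p^d y has level at least m + d >= n. *)
- exists d => x; apply: fn; apply: (trace0_le md); apply: trace0_pX; exact: h1.
have gm' y x : trace0 m y -> g (x + y) = g x.
  move=> hy; have [z zl hz] := h2 _ hy.
  by rewrite -[y](subrK z) addrA gl // gn // (trace0_le md).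
have -> : (fun x => (trace0 m x)%:R) = fun x => (g x1)^-1 * g x + 0 * g x.
  apply/funext => x; rewrite mul0r addr0; have [hx|hx] := boolP (trace0 m x).
    have hxx : trace0 m (x - x1) by rewrite trace0B // gm.
    by rewrite -(subrK x1 x) addrC gm' // mulVf.
  rewrite (_ : g x = 0) ?mulr0 //; apply/eqP; apply: contraNT hx; exact: gm.
(* Closure of [Q] is only under a g + h; the zero function is obtained as - g + g. *)
apply: (Ql _ g (fun x => 0 * g x)) => //.
have -> : (fun x => 0 * g x) = fun x => -1 * g x + g x.
  by apply/funext => x; rewrite mul0r mulN1r addNr.
exact: Ql.
Qed.

End TraceZero.

(** * The unitary group *)

Section UnitaryGroup.
Variables (p q : nat) (E : fieldType) (C : closedFieldType) (D : LFData p q E C).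
Local Notation v := (v D).
Local Notation cj := (cj D).
Local Notation bd := (val_ge D).
Local Notation trace0 := (trace_zero D).
Local Notation inG := (inG D).
Local Notation inB := (inB D).
Local Notation inK := (inK D).
Local Notation s := (smx E).

Definition mx2 (a b c d : E) : 'M[E]_2 :=
  \matrix_(i, j) if i == 0 then (if j == 0 then a else b)
                 else (if j == 0 then c else d).

Lemma mx2E a b c d : (mx2 a b c d 0 0 = a) * (mx2 a b c d 0 1 = b) *
  (mx2 a b c d 1 0 = c) * (mx2 a b c d 1 1 = d).
Proof. by rewrite !mxE. Qed.

Lemma ord2_ind (P : 'I_2 -> Prop) : P 0 -> P 1 -> forall i, P i.
Proof.
move=> P0 P1 [[|[|i]] hi] //.
  by rewrite (_ : Ordinal hi = 0) //; exact: val_inj.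
by rewrite (_ : Ordinal hi = 1) //; exact: val_inj.
Qed.

Lemma mx_m1 (g : 'M[E]_2) : g *m 1 = g.
Proof. exact: mulmx1. Qed.

Lemma mx_1m (g : 'M[E]_2) : 1 *m g = g.
Proof. exact: mul1mx. Qed.

Lemma mx2P (g h : 'M[E]_2) : g 0 0 = h 0 0 -> g 0 1 = h 0 1 ->
  g 1 0 = h 1 0 -> g 1 1 = h 1 1 -> g = h.
Proof.
move=> h1 h2 h3 h4; apply/matrixP.
by apply: ord2_ind; apply: ord2_ind.
Qed.

Lemma mulE (g h : 'M[E]_2) i j : (g *m h) i j = g i 0 * h 0 j + g i 1 * h 1 j.
Proof.
rewrite mxE big_ord_recl big_ord1; congr (_ + g i _ * h _ j); exact/val_inj.
Qed.

Lemma smxE : (s 0 0 = 0) * (s 0 1 = 1) * (s 1 0 = 1) * (s 1 1 = 0).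
Proof. by rewrite !mxE. Qed.

Lemma oneE : ((1 : 'M[E]_2) 0 0 = 1) * ((1 : 'M[E]_2) 0 1 = 0) *
  ((1 : 'M[E]_2) 1 0 = 0) * ((1 : 'M[E]_2) 1 1 = 1).
Proof. by rewrite !mxE. Qed.

Lemma ctrE (g : 'M[E]_2) i j : ctr D g i j = cj (g j i).
Proof. by rewrite !mxE. Qed.

Lemma ctrM g h : ctr D (g *m h) = ctr D h *m ctr D g.
Proof. by rewrite /ctr map_mxM trmx_mul. Qed.

(** The matrix g^* s g is hermitian, so its lower left entry is the conjugate of the upper right
    one. *)
Lemma inGP (g : 'M[E]_2) : reflect
  [/\ cj (g 1 0) * g 0 0 + cj (g 0 0) * g 1 0 = 0,
      cj (g 1 0) * g 0 1 + cj (g 0 0) * g 1 1 = 1 &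
      cj (g 1 1) * g 0 1 + cj (g 0 1) * g 1 1 = 0] (inG g).
Proof.
have e i j : (ctr D g *m s *m g) i j = cj (g 1 i) * g 0 j + cj (g 0 i) * g 1 j.
  by rewrite !mulE !smxE !ctrE !mulr0 !mulr1 add0r addr0.
apply: (iffP eqP) => [h|[h1 h2 h3]].
  by split; rewrite -e h smxE.
apply: mx2P; rewrite e smxE //.
by rewrite -(rmorph1 cj) -h2 rmorphD !rmorphM /= !cj_invol addrC mulrC [X in _ + X]mulrC.
Qed.

Lemma inG1 : inG 1.
Proof. by apply/inGP; rewrite !oneE !rmorph0 rmorph1 !mulr0 !mul0r mul1r !add0r. Qed.

Lemma inGs : inG s.
Proof. by apply/inGP; rewrite !smxE !rmorph0 rmorph1 !mulr0 !mul0r mul1r !addr0. Qed.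

Lemma inGM g h : inG g -> inG h -> inG (g *m h).
Proof.
move=> /eqP hg /eqP hh; apply/eqP.
by rewrite ctrM -!mulmxA (mulmxA s g) (mulmxA (ctr D g)) (mulmxA (ctr D g)) hg mulmxA.
Qed.

(** The inverse on G, from g^* s g = s and s^2 = 1. In this form its entries visibly satisfy the
    same bounds as those of g. *)
Definition ginv (g : 'M[E]_2) := s *m ctr D g *m s.

Lemma ss1 : s *m s = 1.
Proof.
by apply: mx2P; rewrite mulE !smxE !oneE ?mulr0 ?mulr1 ?addr0 ?add0r.
Qed.

Lemma mul_ginv g : inG g -> ginv g *m g = 1.
Proof. by move=> /eqP h; rewrite /ginv -!mulmxA (mulmxA (ctr D g)) h ss1. Qed.

Lemma mulg_inv g : inG g -> g *m ginv g = 1.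
Proof. by move=> h; apply: mulmx1C; exact: mul_ginv. Qed.

Lemma inG_inv g : inG g -> inG (ginv g).
Proof.
move=> hg; have h1 := mulg_inv hg; apply/eqP.
have hs : ctr D s = s by apply: mx2P; rewrite ctrE !smxE ?rmorph0 ?rmorph1.
have cc : ctr D (ctr D g) = g.
  by apply/matrixP => i j; rewrite !ctrE cj_invol.
have -> : ctr D (ginv g) = s *m g *m s by rewrite /ginv !ctrM hs cc mulmxA.
by rewrite -[X in X *m _]mulmxA ss1 mx_m1 -mulmxA h1 mx_m1.
Qed.

Lemma inG_mulr g h : inG h -> inG (g *m h) = inG g.
Proof.
move=> hh; apply/idP/idP => [h0|h0]; last exact: inGM.
by rewrite -[g]mx_m1 -(mulg_inv hh) mulmxA inGM // inG_inv.
Qed.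

Lemma inG_mull g h : inG g -> inG (g *m h) = inG h.
Proof.
move=> hh; apply/idP/idP => [h0|h0]; last exact: inGM.
by rewrite -[h]mx_1m -(mul_ginv hh) -mulmxA inGM // inG_inv.
Qed.

Lemma inB_G b : inB b -> inG b.
Proof. by case/andP. Qed.

Lemma inB_10 b : inB b -> b 1 0 = 0.
Proof. by case/andP => _ /eqP. Qed.

Lemma inB_diag b : inB b -> b 0 0 != 0 /\ b 1 1 = (cj (b 0 0))^-1.
Proof.
move=> hb; have /inGP[_ + _] := inB_G hb.
rewrite inB_10 // rmorph0 mul0r add0r => h.
have b0 : cj (b 0 0) != 0 by apply: contraPneq h => ->; rewrite mul0r => /eqP; rewrite eq_sym oner_eq0.
by split; [rewrite -(fmorph_eq0 cj) | apply: (mulfI b0); rewrite h divff].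
Qed.

Definition nmat b := mx2 1 b 0 1.
Definition nbar c := mx2 1 0 c 1.
Definition tmat a := mx2 a 0 0 (cj a)^-1.
Definition sn x := s *m nmat x.

Lemma inG_n b : inG (nmat b) = (cj b == - b).
Proof.
apply/inGP/eqP; rewrite !mx2E rmorph0 rmorph1 !mul0r ?mulr0 !mul1r ?mulr1 !add0r ?addr0.
  by case=> _ _ /eqP; rewrite addrC addr_eq0 => /eqP.
by move=> ->; rewrite subrr.
Qed.

Lemma inB_n b : cj b = - b -> inB (nmat b).
Proof. by move=> h; rewrite /Defs.inB inG_n h mx2E !eqxx. Qed.

Lemma inG_nbar c : cj c = - c -> inG (nbar c).
Proof.
move=> h; apply/inGP; rewrite !mx2E h rmorph0 rmorph1 ?mulr0 ?mulr1 ?mul1r.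
by rewrite ?mul0r ?add0r ?addNr; split.
Qed.

Lemma inB_t a : a != 0 -> inB (tmat a).
Proof.
move=> a0; rewrite /Defs.inB mx2E eqxx andbT; apply/inGP.
by rewrite !mx2E rmorph0 !mul0r !mulr0 !add0r divff // fmorph_eq0.
Qed.

Lemma snE x : sn x = mx2 0 1 1 x.
Proof.
apply: mx2P; rewrite mulE !smxE !mx2E ?mul0r ?mul1r ?add0r ?addr0 //.
Qed.

Lemma inG_sn x : inG (sn x) = (cj x == - x).
Proof. by rewrite inG_mull ?inGs // inG_n. Qed.

Lemma nmatD a b : nmat (a + b) = nmat a *m nmat b.
Proof.
apply: mx2P; rewrite mulE !mx2E ?mulr0 ?mul0r ?mulr1 ?mul1r ?addr0 ?add0r //.
by rewrite addrC.
Qed.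

Lemma nmat0 : nmat 0 = 1.
Proof. by apply: mx2P; rewrite !mx2E !oneE. Qed.

Lemma snD x y : sn (x + y) = sn x *m nmat y.
Proof. by rewrite /sn nmatD mulmxA. Qed.

(** The lower row is c (1, x) with x = d / c, which determines [sn x]; x has trace zero because
    [sn x] is then unitary. The entry [b 0 0] is recorded since characters of B depend on it
    alone. *)
Lemma bruhat g : inG g -> g 1 0 != 0 -> cj (g 1 1 / g 1 0) = - (g 1 1 / g 1 0) /\
  exists b, [/\ inB b, b 0 0 = (cj (g 1 0))^-1 & g = b *m sn (g 1 1 / g 1 0)].
Proof.
move=> hg c0; set a := g 0 0; set b := g 0 1; set c := g 1 0 in c0 *.
set d := g 1 1; set x := d / c.
have cc0 : cj c != 0 by rewrite fmorph_eq0.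
have /inGP[e1 e2 e3] := hg; rewrite -/a -/b -/c -/d in e1 e2 e3.
have a' : cj a = - (cj c * a) / c.
  by apply: (mulIf c0); rewrite divfK //; apply/eqP; rewrite -addr_eq0 addrC e1.
have b' : b = (cj c)^-1 + a * x.
  apply: (mulfI cc0); rewrite mulrDr divff // -e2 a' /x; field; exact: c0.
pose b0 := mx2 (cj c)^-1 a 0 c.
have gE : g = b0 *m sn x.
  rewrite snE; apply: mx2P; rewrite mulE !mx2E ?mulr0 ?mulr1 ?mul0r ?add0r //.
  by rewrite -/d mulrC divfK.
have hb : inB b0.
  rewrite /Defs.inB mx2E eqxx andbT; apply/inGP.
  rewrite !mx2E rmorph0 fmorphV !mulr0 !mul0r /= cj_invol mulVf // add0r.
  by split; rewrite ?add0r.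
split; last by exists b0; split=> //; rewrite mx2E.
by apply/eqP; rewrite -inG_sn -(inG_mull _ (inB_G hb)) -gE.
Qed.

Definition mbd (n : int) (g : 'M[E]_2) := forall i j, bd n (g i j).

Lemma mbdM m n g h : mbd m g -> mbd n h -> mbd (m + n) (g *m h).
Proof. by move=> hg hh i j; rewrite mulE bdD // bdM. Qed.

Lemma mbd_le m n g : m <= n -> mbd n g -> mbd m g.
Proof. by move=> mn hg i j; apply: bd_le mn _. Qed.

Lemma mbd2 n (g : 'M[E]_2) : bd n (g 0 0) -> bd n (g 0 1) -> bd n (g 1 0) -> bd n (g 1 1) -> mbd n g.
Proof.
by move=> *; apply: ord2_ind; apply: ord2_ind.
Qed.

Lemma inKP (n : nat) g : reflect (inG g /\ mbd n%:Z (g - 1)) (inK n g).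
Proof.
apply: (iffP andP) => -[hg h]; split=> //.
  by move=> i j; move/forallP/(_ i)/forallP/(_ j): h; rewrite inO_divX.
by apply/forallP => i; apply/forallP => j; rewrite inO_divX.
Qed.

Lemma inK_le m n g : (m <= n)%N -> inK n g -> inK m g.
Proof. by move=> mn /inKP[h1 h2]; apply/inKP; split=> //; apply: mbd_le h2. Qed.

Lemma mbd_ctr n g : mbd n g -> mbd n (ctr D g).
Proof. by move=> h i j; rewrite ctrE bd_cj. Qed.

Lemma mbd_s : mbd 0 s.
Proof. by apply: mbd2; rewrite smxE ?bd0 ?bd1. Qed.

Lemma mbd_ginv n g : mbd n g -> mbd n (ginv g).
Proof.
move=> h; rewrite -[n]addr0 -[n + 0]add0r addrA.
by apply: mbdM mbd_s; apply: mbdM mbd_s _; exact: mbd_ctr.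
Qed.

Lemma mbd_exists (g : 'M[E]_2) : exists r : nat, mbd (- r%:Z) g.
Proof.
exists (`|v (g 0%R 0%R)| + `|v (g 0%R 1%R)| + `|v (g 1%R 0%R)| + `|v (g 1%R 1%R)|)%N.
by apply: mbd2; rewrite /val_ge; apply/orP; right; lia.
Qed.

(** If the entries of h have poles of order at most r, so do those of its inverse, and conjugation
    loses at most 2r levels. *)
Lemma inK_conj h n : inG h -> exists m, forall k, inK m k -> inK n (ginv h *m k *m h).
Proof.
move=> hh; have [r hr] := mbd_exists h; exists (n + r + r)%N => k /inKP[hk kb].
apply/inKP; split; first by apply: inGM (inGM (inG_inv hh) hk) hh.
have -> : ginv h *m k *m h - 1 = ginv h *m (k - 1) *m h.
  by rewrite mulmxBr mulmxBl mx_m1 mul_ginv.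
have -> : n%:Z = (- r%:Z + (n + r + r)%N%:Z) + - r%:Z by lia.
by apply: mbdM => //; apply: mbdM => //; exact: mbd_ginv.
Qed.

Lemma inK_inv n k : inK n k -> inK n (ginv k).
Proof.
move=> /inKP[hk kb]; apply/inKP; split; first exact: inG_inv.
have -> : ginv k - 1 = ginv (k - 1).
  rewrite /ginv -[in LHS]ss1 -[X in _ - X *m _]mx_m1 -mulmxBl -mulmxBr.
  congr (s *m _ *m s); rewrite /ctr map_mxB map_mx1 linearB /=; by rewrite trmx1.
exact: mbd_ginv.
Qed.

Lemma inK_n (n : nat) b : trace0 n%:Z b -> inK n (nmat b).
Proof.
move=> /andP[cb bb]; apply/inKP; split; first by rewrite inG_n.
by apply: mbd2; rewrite !mxE /= ?subrr ?subr0 ?bd0.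
Qed.

Lemma inK_nbar (n : nat) b : trace0 n%:Z b -> inK n (nbar b).
Proof.
move=> /andP[/eqP cb bb]; apply/inKP; split; first by rewrite inG_nbar.
by apply: mbd2; rewrite !mxE /= ?subrr ?subr0 ?bd0.
Qed.

Lemma inK_entries (n : nat) k : inK n k -> [/\ inG k, bd n%:Z (k 0 0 - 1), bd n%:Z (k 0 1),
  bd n%:Z (k 1 0) & bd n%:Z (k 1 1 - 1)].
Proof.
move=> /inKP[hk kb]; split=> //.
- by have := kb 0 0; rewrite !mxE.
- by have := kb 0 1; rewrite !mxE /= subr0.
- by have := kb 1 0; rewrite !mxE /= subr0.
- by have := kb 1 1; rewrite !mxE.
Qed.

End UnitaryGroup.

(** * Induced representations *)

Section Induced.
Variables (p q : nat) (E : fieldType) (C : closedFieldType) (D : LFData p q E C).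
Local Notation unif := (unif D).
Local Notation cj := (cj D).
Local Notation bd := (val_ge D).
Local Notation trace0 := (trace_zero D).
Local Notation inG := (inG D).
Local Notation inB := (inB D).
Local Notation inK := (inK D).
Local Notation s := (smx E).
Local Notation tmat := (tmat D).
Local Notation ginv := (ginv D).

(** By [smooth_charB] below, every smooth character of B is given by such an X. *)
Variable X : E -> C.
Hypotheses (XM : forall a b : E, a != 0 -> b != 0 -> X (a * b) = X a * X b)
  (X0 : forall a : E, a != 0 -> X a != 0)
  (X_near1 : forall a, bd 1 (a - 1) -> X a = 1).

Local Notation I := (IndSpace D (fun b => X (b 0 0))).

Lemma X_1 : X 1 = 1.
Proof. by apply: X_near1; rewrite subrr bd0. Qed.

Lemma XV a : a != 0 -> X a^-1 = (X a)^-1.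
Proof.
move=> a0; apply: (mulfI (X0 a0)).
by rewrite -XM ?invr_neq0 // !divff ?X0 // X_1.
Qed.

Lemma lcomb0 (f : Fun E C) : lcomb (-1) f f = fun=> 0.
Proof. by apply/funext => g; rewrite /lcomb mulN1r addNr. Qed.

Lemma lcombZ (a : C) (f : Fun E C) : lcomb a f (fun=> 0) = fun g => a * f g.
Proof. by apply/funext => g; rewrite /lcomb addr0. Qed.

Lemma lcombB (f h : Fun E C) : lcomb (-1) f h = fun g => h g - f g.
Proof. by apply/funext => g; rewrite /lcomb mulN1r addrC. Qed.

Lemma ind_0 : I (fun=> 0).
Proof. by split=> // *; [rewrite mulr0 | exists 0%N]. Qed.

Lemma ind_lcomb a f h : I f -> I h -> I (lcomb a f h).
Proof.
move=> [f1 f2 [n f3]] [h1 h2 [m h3]]; rewrite /lcomb; split.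
- by move=> g hg; rewrite f1 // h1 // mulr0 addr0.
- by move=> b g hb hg; rewrite f2 // h2 // mulrDr mulrCA.
exists (maxn n m) => g k hg hk.
by rewrite (f3 g k) ?(h3 g k) //; apply: inK_le hk; rewrite ?leq_maxl ?leq_maxr.
Qed.

Lemma ind_rt h f : inG h -> I f -> I (rt h f).
Proof.
move=> hh [f1 f2 [n f3]]; rewrite /rt; split.
- by move=> g hg; rewrite f1 // inG_mulr.
- by move=> b g hb hg; rewrite -mulmxA f2 // inG_mulr.
have [m hm] := inK_conj n hh; exists m => g k hg hk.
rewrite -[RHS](f3 _ (ginv h *m k *m h)) ?inG_mulr //; last exact: hm.
rewrite -(mulmxA (ginv h) k h) (mulmxA (g *m h) (ginv h)).
by rewrite -(mulmxA g h (ginv h)) mulg_inv // mx_m1 mulmxA.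
Qed.

Lemma ind_B f b : I f -> inB b -> f b = X (b 0 0) * f 1.
Proof. by move=> [_ f2 _] hb; rewrite -[in LHS](mx_m1 b) f2 ?inG1. Qed.

Lemma ind_big f g : I f -> inG g -> g 1 0 != 0 ->
  f g = X (cj (g 1 0))^-1 * f (sn (g 1 1 / g 1 0)).
Proof.
move=> [_ f2 _] hg g0; have [cx [b [hb b0 gE]]] := bruhat hg g0.
by rewrite {1}gE f2 // ?b0 // inG_sn cx.
Qed.

(** B\G is the line of trace-zero x, via [sn x], together with the point at infinity 1. *)
Lemma ind_ext f f' : I f -> I f' -> f 1 = f' 1 ->
  (forall x, cj x = - x -> f (sn x) = f' (sn x)) -> f = f'.
Proof.
move=> hf hf' e1 es; apply/funext => g.
have [hg|hg] := boolP (inG g); last first.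
  by case: hf => f1 _ _; case: hf' => f1' _ _; rewrite f1 // f1'.
have [g0|g0] := eqVneq (g 1 0) 0.
  have hb : inB g by rewrite /Defs.inB hg g0 eqxx.
  by rewrite (ind_B hf hb) (ind_B hf' hb) e1.
by rewrite (ind_big hf) // (ind_big hf') // es //; case: (bruhat hg g0).
Qed.

Lemma ind_sn0 f x : I f -> cj x != - x -> f (sn x) = 0.
Proof. by move=> [f1 _ _] hx; rewrite f1 // inG_sn. Qed.

Lemma ind_sn_invariant f : I f -> exists n : nat,
  forall x y, trace0 n%:Z y -> f (sn (x + y)) = f (sn x).
Proof.
move=> hf; have [_ _ [n f3]] := hf; exists n => x y hy.
have [cy _] := andP hy.
have [cx|cx] := boolP (cj x == - x).
  by rewrite snD f3 ?inG_sn // inK_n.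
(* If x is not of trace zero then neither is x + y, and both values are 0. *)
rewrite !ind_sn0 //; apply: contra cx => /eqP.
by rewrite rmorphD /= (eqP cy) opprD => /addIr ->.
Qed.

(* [sn x] lies in [B *m nbar x^-1], and [nbar x^-1] is close to 1 when [x] is large. *)
Lemma sn_large x : x != 0 -> cj x = - x ->
  exists2 b, inB b & b 0 0 = - x^-1 /\ sn x = b *m nbar x^-1.
Proof.
move=> x0 cx; exists (mx2 (- x^-1) 1 0 x).
  rewrite /Defs.inB mx2E eqxx andbT; apply/inGP.
  rewrite !mx2E rmorph0 rmorph1 rmorphN fmorphV /= cx !mulr0 !mul0r mulr1 mul1r.
  by rewrite invrN opprK mulVf // addr0 add0r addNr.
split; first by rewrite mx2E.
rewrite snE; apply: mx2P; rewrite mulE !mx2E ?mulr0 ?mul0r ?add0r ?mulr1 ?mul1r //.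
  by rewrite addNr.
by rewrite divff.
Qed.

Lemma ind_sn_large f : I f -> exists n : nat, forall x, x != 0 -> cj x = - x ->
  bd n%:Z x^-1 -> f (sn x) = X (- x^-1) * f 1.
Proof.
move=> [_ f2 [n f3]]; exists n => x x0 cx hx.
have [b hb [b0 ->]] := sn_large x0 cx.
have cx' : cj x^-1 = - x^-1 by rewrite fmorphV /= cx invrN.
rewrite f2 ?inG_nbar // b0 -[nbar _]mx_1m f3 ?inG1 // inK_nbar //.
by rewrite /trace_zero cx' eqxx.
Qed.

(** [sn x] tends to the coset of 1 as x grows, so vanishing at 1 is compact support in x. *)
Lemma ind_support f : I f -> f 1 = 0 -> exists n : nat,
  forall x, f (sn x) != 0 -> trace0 (- n%:Z) x.
Proof.
move=> hf f0; have [n hn] := ind_sn_large hf; exists n => x hx.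
have cx : cj x = - x by apply/eqP; apply: contraNT hx => cx; rewrite ind_sn0.
rewrite /trace_zero cx eqxx /=; have [->|x0] := eqVneq x 0; first exact: bd0.
apply: contraNT hx; rewrite bd_neq0 // => hv; rewrite hn // ?f0 ?mulr0 //.
rewrite bd_neq0 ?invr_neq0 // vV //; lia.
Qed.

(** Conjugation by [tmat a] rescales N by the norm of a, and s exchanges [tmat a] with
    [tmat (cj a)^-1]. *)
Lemma ind_sn_t f a x : I f -> a != 0 ->
  f (sn x *m tmat a) = X (cj a)^-1 * f (sn (x / (a * cj a))).
Proof.
move=> hf a0; have ca0 : cj a != 0 by rewrite fmorph_eq0.
have ht : inB (tmat (cj a)^-1) by rewrite inB_t // invr_neq0.
have e : sn x *m tmat a = tmat (cj a)^-1 *m sn (x / (a * cj a)).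
  rewrite !snE; apply: mx2P; rewrite !mulE !mx2E ?mulr0 ?mul0r ?add0r ?addr0 ?mulr1 ?mul1r //.
    by rewrite fmorphV /= cj_invol invrK.
  by rewrite fmorphV /= cj_invol invrK; field; rewrite a0 ca0.
have [f1 f2 _] := hf.
have [hg|hg] := boolP (inG (sn (x / (a * cj a)))).
  by rewrite e f2 // mx2E.
rewrite (f1 _ hg) mulr0 f1 // e inG_mull //; exact: inB_G.
Qed.

(* Supported on [B s N_j], where [N_j] is the set of [nmat x] with [trace0 j x]. *)
Definition phi (j : int) : Fun E C := fun g =>
  if [&& inG g, g 1 0 != 0 & bd j (g 1 1 / g 1 0)] then (X (cj (g 1 0)))^-1 else 0.

(** The bound 1 - j <= n keeps the new lower left entry equal to the old one up to a principal unit,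
    on which X is 1; the bound j <= n keeps the coordinate in the lattice. *)
Lemma phi_cond_K j n g k : (1 <= n)%N -> j <= n%:Z -> 1 - j <= n%:Z ->
  inK n k -> [&& inG g, g 1 0 != 0 & bd j (g 1 1 / g 1 0)] ->
  [&& inG (g *m k), (g *m k) 1 0 != 0 & bd j ((g *m k) 1 1 / (g *m k) 1 0)] /\
  phi j (g *m k) = phi j g.
Proof.
move=> n1 jn jn' hk hg; have := hg => /and3P[gG c0 hx].
have [kG k00 k01 k10 k11] := inK_entries hk.
set c := g 1 0 in c0 hx; set d := g 1 1 in hx; set x := d / c in hx.
have dE : d = c * x by rewrite mulrC divfK.
(* The factor by which right multiplication by k changes the lower left entry. *)
pose e := k 0 0 + x * k 1 0.
have he : bd 1 (e - 1).
  rewrite /e addrAC bdD //; first exact: (bd_le _ k00).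
  apply: (@bd_le _ _ _ _ _ _ (j + n%:Z)); first lia.
  exact: bdM.
have [e0 ve] := bd1_unit he.
have E10 : (g *m k) 1 0 = c * e by rewrite mulE -/c -/d dE /e mulrDr mulrA.
have E11 : (g *m k) 1 1 = c * (k 0 1 + x * k 1 1).
  by rewrite mulE -/c -/d dE mulrDr mulrA.
have cond : [&& inG (g *m k), (g *m k) 1 0 != 0 & bd j ((g *m k) 1 1 / (g *m k) 1 0)].
  rewrite inG_mulr // gG E10 mulf_neq0 //= E11.
  have -> : c * (k 0 1 + x * k 1 1) / (c * e) = e^-1 * (k 0 1 + k 1 1 * x).
    by rewrite [k 1 1 * x]mulrC; field; rewrite c0 e0.
  apply: bdM0; first by rewrite bd_neq0 ?invr_neq0 // vV // ve.
  rewrite bdD //; first exact: (bd_le jn).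
  apply: bdM0 => //; rewrite -[k 1 1](subrK 1) bdD ?bd1 //; exact: (bd_le _ k11).
split=> //; rewrite /phi cond hg E10 rmorphM /= XM ?fmorph_eq0 //.
by rewrite [X (cj e)]X_near1 ?mulr1 // -(rmorph1 cj) -rmorphB /= bd_cj.
Qed.

Lemma phi_K j n g k : (1 <= n)%N -> j <= n%:Z -> 1 - j <= n%:Z ->
  inK n k -> phi j (g *m k) = phi j g.
Proof.
move=> n1 n2 n3 hk.
case h1 : [&& inG g, g 1 0 != 0 & bd j (g 1 1 / g 1 0)].
  by case: (phi_cond_K n1 n2 n3 hk h1).
(* If g k is in the support, then g = (g k) k^-1 is too, since k^-1 lies in the same congruence
   subgroup. *)
case h2 : [&& inG (g *m k), (g *m k) 1 0 != 0 & bd j ((g *m k) 1 1 / (g *m k) 1 0)].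
  have [] := phi_cond_K n1 n2 n3 (inK_inv hk) h2.
  by have [kG _] := inKP _ _ _ hk; rewrite -mulmxA mulg_inv // mx_m1 h1.
by rewrite /phi h1 h2.
Qed.

Lemma phi_ind j : I (phi j).
Proof.
split.
- by move=> g /negPf hg; rewrite /phi hg.
- move=> b g hb hg; have [b0 b11] := inB_diag hb.
  have cb0 : cj (b 0 0) != 0 by rewrite fmorph_eq0.
  rewrite /phi (inG_mull _ (inB_G hb)) hg !mulE (inB_10 hb) !mul0r !add0r b11 /=.
  rewrite mulf_eq0 invr_eq0 (negPf cb0) /=.
  have [g0|g0] := eqVneq (g 1 0) 0; first by rewrite mulr0.
  have -> : (cj (b 0 0))^-1 * g 1 1 / ((cj (b 0 0))^-1 * g 1 0) = g 1 1 / g 1 0.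
    by field; rewrite cb0 g0.
  case: ifP => _; last by rewrite mulr0.
  rewrite rmorphM fmorphV /= cj_invol XM ?invr_neq0 ?fmorph_eq0 // XV //.
  by rewrite invfM invrK.
exists (1 + `|j|)%N => g k _ hk; apply: phi_K hk; lia.
Qed.

Lemma phi_1 j : phi j 1 = 0.
Proof. by rewrite /phi oneE eqxx andbF. Qed.

Lemma phi_sn j x : phi j (sn x) = (trace0 j x)%:R.
Proof.
rewrite /phi inG_sn snE !mx2E oner_eq0 divr1 rmorph1 X_1 invr1 /= -/(trace0 j x).
by case: (trace0 j x).
Qed.

Lemma phi_s j : phi j s = 1.
Proof.
have -> : s = sn 0 by rewrite /sn nmat0 mx_m1.
by rewrite phi_sn trace00.
Qed.

(* On the big cell, the functions [f] in [Q] with [f 1 = 0] are locally constant with compact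
   support on the group [N] of the [nmat x]. A p-group acting in characteristic p fixes a
   nonzero vector, so [Q] contains the indicator of a lattice of [N]; the torus shrinks this
   lattice, and the translates of the small lattices span everything. *)
Lemma ind_borel_irreducible (Q : Fun E C -> Prop) (f0 : Fun E C) :
  FSubspace Q -> (forall b f, inB b -> Q f -> Q (rt b f)) ->
  Q f0 -> I f0 -> f0 1 = 0 -> f0 <> (fun=> 0) ->
  forall f, I f -> f 1 = 0 -> Q f.
Proof.
move=> [Q0 Ql] Qb Qf0 If0 f01 f0n f If f1.
(* The big-cell coordinates of the members of [Q] that vanish at 1. *)
pose R (g : E -> C) := exists h, [/\ Q h, I h, h 1 = 0 & forall x, h (sn x) = g x].
have R0 : R (fun=> 0) by exists (fun=> 0); split=> //; exact: ind_0.
have Rl a g h : R g -> R h -> R (fun x => a * g x + h x).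
  move=> [g' [g1 g2 g3 g4]] [h' [h1 h2 h3 h4]]; exists (lcomb a g' h'); split.
  - exact: Ql.
  - exact: ind_lcomb.
  - by rewrite /lcomb g3 h3 mulr0 addr0.
  - by move=> x; rewrite /lcomb g4 h4.
have Rt y g : cj y = - y -> R g -> R (fun x => g (x + y)).
  move=> cy [h [h1 h2 h3 h4]]; have hb := inB_n cy; exists (rt (nmat y) h); split.
  - exact: Qb.
  - by apply: ind_rt => //; exact: inB_G.
  - by rewrite /rt mx_1m ind_B // h3 mulr0.
  - by move=> x; rewrite /rt -snD h4.
have Rd a g : a != 0 -> R g -> R (fun x => g (x / (a * cj a))).
  move=> a0 [h [h1 h2 h3 h4]]; have hb := inB_t D a0.
  have ca0 : cj a != 0 by rewrite fmorph_eq0.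
  exists (lcomb (X (cj a)) (rt (tmat a) h) (fun=> 0)); rewrite lcombZ.
  split.
  - rewrite -lcombZ; apply: Ql => //; exact: Qb.
  - rewrite -lcombZ; apply: ind_lcomb; last exact: ind_0.
    by apply: ind_rt => //; exact: inB_G.
  - by rewrite /rt mx_1m ind_B // h3 !mulr0.
  - by move=> x; rewrite /rt ind_sn_t // XV // mulVKf ?X0 // h4.
have [x0 hx0] : exists x0, f0 (sn x0) != 0.
  apply: contrapT => /forallNP h; apply: f0n; apply: ind_ext => //; first exact: ind_0.
  by move=> x _; apply/eqP/negPn/negP/h.
have [m hm] := ind_support If0 f01.
have [n hn] := ind_sn_invariant If0.
have Rm : R (fun x => (trace0 (- m%:Z) x)%:R).
  apply: (@indicator_of_invariant _ _ _ _ D _ R n (fun x => f0 (sn x)) x0) => //.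
  - by move=> y g /andP[/eqP cy _]; exact: Rt.
  - by exists f0.
(* The norm of [unif ^+ k] is [unif ^+ (2 * k)], so the torus raises the level in steps of 2. *)
have Rmk (k : nat) : R (fun x => (trace0 (- m%:Z + k%:Z * 2) x)%:R).
  have a0 : unif ^+ k != 0 by rewrite expf_neq0 // unif_neq0.
  have := Rd _ _ a0 Rm; congr R; apply/funext => x; congr (nat_of_bool _)%:R.
  rewrite rmorphXn /= unif_cj -exprD addnn -mul2n.
  rewrite /trace_zero [cj (_ / _)]rmorphM fmorphV rmorphXn /= unif_cj -mulNr.
  rewrite (_ : unif ^+ (2 * k) = unif ^ (2 * k)%N%:Z) // bd_divX.
  rewrite (inj_eq (mulIf _)) ?invr_neq0 ?unifX_neq0 //; congr (_ && bd _ _); lia.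
have [m' hm'] := ind_support If f1.
have [n' hn'] := ind_sn_invariant If.
(* A level of this form that is at least n', so that f is constant on cosets of its lattice. *)
pose N : int := - m%:Z + (m + n')%:Z * 2.
have nN : n'%:Z <= N by rewrite /N; lia.
have [l [l1 l2]] := trace0_reps D (- m'%:Z) (absz (N + m'%:Z)).
have NE : - m'%:Z + (absz (N + m'%:Z))%:Z = N by lia.
have [|||||h [h1 h2 h3 h4]] :=
  @indicator_span E C (trace0 N) R l (fun x => f (sn x)) _ _ R0 Rl.
- by move=> x y; exact: trace0D.
- by move=> x; exact: trace0N.
- move=> y yl; have /andP[/eqP cy _] := l1 _ yl.
  by apply: (Rt (- y) _ _ (Rmk (m + n')%N)); rewrite rmorphN /= cy.
- by move=> x y hy; apply: hn'; exact: (trace0_le nN).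
- by move=> x hx; have [y yl hy] := l2 _ (hm' _ hx); exists y => //; rewrite -NE.
have -> // : f = h.
by apply: ind_ext => //; rewrite ?f1 ?h3 // => x _; rewrite h4.
Qed.

End Induced.

(** * Characters *)

Section Characters.
Variables (p q : nat) (E : fieldType) (C : closedFieldType) (D : LFData p q E C).
Local Notation v := (v D).
Local Notation unif := (unif D).
Local Notation cj := (cj D).
Local Notation red := (red D).
Local Notation bd := (val_ge D).
Local Notation omega := (omega D).
Local Notation mu := (mu D).
Local Notation inG := (inG D).
Local Notation inB := (inB D).
Local Notation inK := (inK D).
Local Notation s := (smx E).
Local Notation tmat := (tmat D).

Lemma unit_part a : a != 0 ->
  a * unif ^ (- v a) != 0 /\ v (a * unif ^ (- v a)) = 0.
Proof.
move=> a0; rewrite mulf_neq0 ?unifX_neq0 //; split=> //.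
by rewrite v_mul ?unifX_neq0 // v_unifX subrr.
Qed.

Lemma omega_neq0 a : a != 0 -> omega a != 0.
Proof. by move=> a0; have [h1 h2] := unit_part a0; exact: red_neq0. Qed.

Lemma omega_red a : v a = 0 -> omega a = red a.
Proof. by move=> va; rewrite /Defs.omega va oppr0 expr0z mulr1. Qed.

Lemma bd_unit a : a != 0 -> v a = 0 -> bd 0 a.
Proof. by move=> a0 va; rewrite bd_neq0 // va. Qed.

Lemma omegaM a b : a != 0 -> b != 0 -> omega (a * b) = omega a * omega b.
Proof.
move=> a0 b0; have [h1 h2] := unit_part a0; have [h3 h4] := unit_part b0.
rewrite /Defs.omega v_mul // -redM ?bd_unit //; congr red.
by rewrite opprD expfzDr ?unif_neq0 // mulrACA.
Qed.

Lemma omega_unif : omega unif = 1.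
Proof. by rewrite /Defs.omega unif_v divff ?unif_neq0 // red_one. Qed.

Lemma omega_1 : omega 1 = 1.
Proof. by rewrite omega_red ?v1 // red_one. Qed.

Lemma omega_cj a : a != 0 -> omega (cj a) = omega a ^+ q.
Proof.
move=> a0; have [h1 h2] := unit_part a0.
rewrite /Defs.omega -red_cj ?bd_unit // rmorphM /= fmorphXz unif_cj v_cj'.
by [].
Qed.

Lemma omega_order a : a != 0 -> omega a ^+ (q ^ 2).-1 = 1.
Proof.
move=> a0; have [h1 h2] := unit_part a0.
have [z [z0 vz pz hz]] := residue_gen D; have [i e] := hz _ h1 h2.
by rewrite /Defs.omega e -exprM mulnC exprM (prim_expr_order pz) expr1n.
Qed.

Lemma omega_near1 a : bd 1 (a - 1) -> omega a = 1.
Proof.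
move=> h; have [a0 va] := bd1_unit h; rewrite omega_red //.
by apply/eqP; rewrite -(red_one D) red_eq ?bd1 ?bd_unit.
Qed.

Definition tchar (lam : C) (r : nat) (a : E) : C := mu lam a * omega a ^+ r.

Lemma tcharM lam r : lam != 0 -> forall a b, a != 0 -> b != 0 ->
  tchar lam r (a * b) = tchar lam r a * tchar lam r b.
Proof.
move=> l0 a b a0 b0; rewrite /tchar /Defs.mu v_mul // expfzDr // omegaM //.
by rewrite exprMn mulrACA.
Qed.

Lemma tchar_neq0 lam r : lam != 0 -> forall a, a != 0 -> tchar lam r a != 0.
Proof.
by move=> l0 a a0; rewrite mulf_neq0 ?expfz_neq0 ?expf_neq0 ?omega_neq0.
Qed.

Lemma tchar_near1 lam r : forall a, bd 1 (a - 1) -> tchar lam r a = 1.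
Proof.
move=> a h; have [a0 va] := bd1_unit h.
by rewrite /tchar /Defs.mu va expr0z mul1r omega_near1 // expr1n.
Qed.

Lemma tchar_unif lam r : tchar lam r unif = lam.
Proof. by rewrite /tchar /Defs.mu unif_v expr1z omega_unif expr1n mulr1. Qed.

Lemma tchar_unit lam r a : v a = 0 -> tchar lam r a = red a ^+ r.
Proof. by move=> va; rewrite /tchar /Defs.mu va expr0z mul1r omega_red. Qed.

Lemma tchar_inj lam lam' r r' : (r < q ^ 2 - 1)%N -> (r' < q ^ 2 - 1)%N ->
  (forall a, a != 0 -> tchar lam r a = tchar lam' r' a) -> lam = lam' /\ r = r'.
Proof.
move=> hr hr' h; split; first by have := h _ (unif_neq0 D); rewrite !tchar_unif.
have [z [z0 vz pz hz]] := residue_gen D.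
have := h _ z0; rewrite !tchar_unit // => /eqP.
by rewrite (eq_prim_root_expr pz) -subn1 !modn_small // => /eqP.
Qed.

Lemma expX_int (X : E -> C) (a : E) (z : int) :
  (forall a b : E, a != 0 -> b != 0 -> X (a * b) = X a * X b) ->
  (forall a : E, a != 0 -> X a != 0) -> X 1 = 1 -> a != 0 ->
  X (a ^ z) = X a ^ z.
Proof.
move=> XM X0 X1 a0.
have XX n : X (a ^+ n) = X a ^+ n.
  by elim: n => [|n IH]; rewrite ?X1 // !exprS XM ?expf_neq0 // IH.
case: z => n; first by rewrite -!exprnP XX.
rewrite NegzE -!invr_expz -!exprnP; apply: (mulfI (expf_neq0 n.+1 (X0 _ a0))).
by rewrite -{1}XX -XM ?invr_neq0 ?expf_neq0 // !divff ?X1 ?expf_neq0 // X0.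
Qed.

(* The pro-p group [1 + unif o_E] has no nontrivial smooth character to [C],
   and neither do the unipotent elements of [B]. *)
Lemma smooth_charB chi : SmoothCharB D chi -> exists lam r,
  [/\ lam != 0, (r < q ^ 2 - 1)%N & forall b, inB b -> chi b = tchar lam r (b 0 0)].
Proof.
move=> [chi0 chiM [n chin]].
have hB1 : inB 1 by rewrite /Defs.inB inG1 oneE eqxx.
have chi1 : chi 1 = 1.
  apply: chin => //; apply/inKP; split; first exact: inG1.
  by move=> i j; rewrite subrr mxE bd0.
have chi_n b : cj b = - b -> chi (nmat b) = 1.
  move=> cb; have cbk k : cj (b *+ k) = - (b *+ k) by rewrite raddfMn /= cb mulNrn.
  have chik k : chi (nmat (b *+ k)) = chi (nmat b) ^+ k.
    elim: k => [|k IH]; first by rewrite mulr0n nmat0 chi1.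
    by rewrite mulrS nmatD chiM ?inB_n // IH exprS.
  (* With this exponent p^e b has level at least n, whatever the sign of v b. *)
  apply: (@pchar_expX1 _ _ _ _ D _ (n + `|v b|)%N).
  rewrite -chik; apply: chin; first exact: inB_n.
  apply: inK_n.
  have hb : trace_zero D (v b) b by rewrite /trace_zero cb eqxx /val_ge lexx orbT.
  apply: trace0_le (trace0_pX (n + `|v b|) hb); lia.
pose Y a := chi (tmat a).
have Y0 a : a != 0 -> Y a != 0 by move=> a0; apply/chi0/inB_t.
have YM a b : a != 0 -> b != 0 -> Y (a * b) = Y a * Y b.
  move=> a0 b0; rewrite /Y -chiM ?inB_t //; congr chi.
  apply: mx2P; rewrite mulE !mx2E ?mulr0 ?mul0r ?add0r ?addr0 //.
  by rewrite rmorphM invfM.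
have Y1 : Y 1 = 1.
  rewrite /Y -chi1; congr chi; apply: mx2P; rewrite !mx2E ?oneE //.
  by rewrite rmorph1 invr1.
have Yn a : bd 1 (a - 1) -> Y a = 1.
  move=> ha; apply: (@pchar_expX1 _ _ _ _ D _ n).
  have [a0 va] := bd1_unit ha.
  rewrite exprnP -expX_int // -exprnP; set c := a ^+ _.
  have hc : bd n%:Z (c - 1) by apply: bd_le (bd_expp n ha); lia.
  have [c0 vc] : c != 0 /\ v c = 0 by rewrite expf_neq0 // vX // va mulr0.
  have cc0 : cj c != 0 by rewrite fmorph_eq0.
  apply: chin; first exact: inB_t.
  apply/inKP; split; first by apply/inB_G/inB_t.
  apply: mbd2; rewrite !mxE /= ?subrr ?subr0 ?bd0 //.
  have -> : (cj c)^-1 - 1 = (cj c)^-1 * - (cj (c - 1)).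
    by rewrite rmorphB rmorph1; field.
  by rewrite bdM0 ?bdN ?bd_cj // bd_neq0 ?invr_neq0 // vV // v_cj' vc.
have [z [z0 vz pz hz]] := residue_gen D.
(* z^(q^2-1) is a principal unit, so Y z is a power of the primitive root [red z]; its exponent is
   r. *)
have YzN : Y z ^+ (q ^ 2).-1 = 1.
  rewrite exprnP -expX_int // -exprnP; apply: Yn.
  rewrite -red_eq ?bd1 ?bdX ?bd_unit // redX ?bd_unit //.
  by rewrite (prim_expr_order pz) red_one.
have [r hr] := prim_rootP pz YzN.
exists (Y unif), r; split.
- exact/Y0/unif_neq0.
- by rewrite subn1.
move=> b hb; have [b0 b11] := inB_diag hb.
have bE : b = tmat (b 0 0) *m nmat (b 0 1 / b 0 0).
  apply: mx2P; rewrite mulE !mx2E ?mulr0 ?mul0r ?mulr1 ?add0r ?addr0 //.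
    by rewrite mulrC divfK.
  exact: (inB_10 hb).
have cx : cj (b 0 1 / b 0 0) = - (b 0 1 / b 0 0).
  have := inB_G hb; rewrite {1}bE (inG_mull _ (inB_G (inB_t D b0))) inG_n.
  by move/eqP.
rewrite {1}bE chiM ?inB_t ?inB_n // chi_n // mulr1 -/(Y _).
set a := b 0 0 in b0 *; have [u0 vu] := unit_part b0.
set u := a * _ in u0 vu.
have aE : a = u * unif ^ (v a).
  by rewrite /u -mulrA -expfzDr ?unif_neq0 // addNr expr0z mulr1.
rewrite /tchar /Defs.mu {1}aE YM ?unifX_neq0 // expX_int ?unif_neq0 // mulrC.
congr (_ * _); have [i ei] := hz _ u0 vu.
rewrite /Defs.omega -/u ei -exprM mulnC exprM -hr.
have zi0 : z ^+ i != 0 by rewrite expf_neq0.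
have vzi : v (z ^+ i) = 0 by rewrite vX // vz mulr0.
(* The second factor reduces to 1, so Y is trivial on it. *)
have -> : u = z ^+ i * (u / z ^+ i) by rewrite mulrC divfK.
have w0 : u / z ^+ i != 0 by rewrite mulf_neq0 ?invr_neq0.
have vw : v (u / z ^+ i) = 0 by rewrite v_mul ?invr_neq0 // vV // vzi vu subrr.
rewrite YM // exprnP expX_int // -!exprnP [X in _ * X]Yn ?mulr1 //.
rewrite -red_eq ?bd1 ?bd_unit // redM ?bd_unit ?invr_neq0 // ?vV // ?vzi //.
by rewrite redV // redX ?bd_unit // ei divff ?red_one // expf_neq0 // red_neq0.
Qed.

Lemma det2 (g : 'M[E]_2) : \det g = g 0 0 * g 1 1 - g 0 1 * g 1 0.
Proof.
rewrite (expand_det_row _ 0) !big_ord_recl big_ord0 addr0 /cofactor !det_mx11 !mxE.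
have -> : lift 0 0 = 1 :> 'I_2 by exact: val_inj.
have -> : lift 1 0 = 0 :> 'I_2 by exact: val_inj.
by rewrite /= expr0 expr1 mul1r mulN1r mulrN.
Qed.

Lemma det_norm g : inG g -> cj (\det g) * \det g = 1.
Proof.
move=> /eqP/(congr1 determinant); rewrite !det_mulmx.
rewrite /ctr det_tr det_map_mx mulrAC => /eqP.
have s0 : \det s != 0 by rewrite det2 !smxE mul0r sub0r mulr1 oppr_eq0 oner_eq0.
by rewrite -{2}[\det s]mul1r (inj_eq (mulIf s0)) => /eqP.
Qed.

Lemma det_unit g : inG g -> \det g != 0 /\ v (\det g) = 0.
Proof.
move=> /det_norm h; have d0 : \det g != 0.
  by apply: contraPneq h => ->; rewrite mulr0 => /eqP; rewrite eq_sym oner_eq0.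
split=> //; have := congr1 v h.
by rewrite v_mul ?fmorph_eq0 // v1 v_cj'; lia.
Qed.

(** The value 0 off G makes it a possible element of an induced space. *)
Definition det_char (k : nat) : Fun E C := fun g => if inG g then omega (\det g) ^+ k else 0.
Local Notation detc := det_char.

Lemma detcE k g : inG g -> detc k g = omega (\det g) ^+ k.
Proof. by rewrite /det_char => ->. Qed.

Lemma detcM k g h : inG g -> inG h -> detc k (g *m h) = detc k g * detc k h.
Proof.
move=> hg hh; have [d0 _] := det_unit hg; have [d0' _] := det_unit hh.
by rewrite !detcE ?inGM // det_mulmx omegaM // exprMn.
Qed.

Lemma detc_neq0 k g : inG g -> detc k g != 0.
Proof. by move=> hg; have [d0 _] := det_unit hg; rewrite detcE // expf_neq0 // omega_neq0. Qed.

(** The determinant has norm 1 and omega (cj a) = omega a ^ q. Hence exponents of omega o det matter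
    modulo q + 1. *)
Lemma omega_det_order g : inG g -> omega (\det g) ^+ q.+1 = 1.
Proof.
move=> hg; have [d0 dv] := det_unit hg.
by rewrite exprSr -omega_cj // -omegaM ?fmorph_eq0 // det_norm // omega_1.
Qed.

Lemma detc_n k b : cj b = - b -> detc k (nmat b) = 1.
Proof.
move=> h; rewrite detcE ?inG_n ?h // det2 !mx2E mulr0 subr0 mulr1 omega_1.
by rewrite expr1n.
Qed.

Lemma detc_1 k : detc k 1 = 1.
Proof. by rewrite detcE ?inG1 // det1 omega_1 expr1n. Qed.

Lemma detc_K k g : inK 1 g -> detc k g = 1.
Proof.
move=> hg; have [gG g1 g2 g3 g4] := inK_entries hg.
rewrite detcE // omega_near1 ?expr1n //.
have -> : \det g - 1 = g 1 1 * (g 0 0 - 1) + (g 1 1 - 1) - g 0 1 * g 1 0.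
  by rewrite det2; ring.
have h1 : bd 0 (g 1 1) by rewrite -[g 1 1](subrK 1) bdD ?bd1 // (bd_le _ g4).
apply: bdB; first by apply: bdD => //; exact: bdM0.
by apply: bdM0 => //; exact: (bd_le _ g2).
Qed.

Lemma detc_ind k (X : E -> C) :
  (forall b, inB b -> omega (\det b) ^+ k = X (b 0 0)) ->
  IndSpace D (fun b => X (b 0 0)) (detc k).
Proof.
move=> h; split.
- by move=> g /negPf hg; rewrite /det_char hg.
- by move=> b g hb hg; rewrite (detcM _ (inB_G hb) hg) (detcE _ (inB_G hb)) h.
exists 1%N => g k' hg hk; have [kG _] := inKP _ _ _ hk.
by rewrite detcM // (detc_K _ hk) mulr1.
Qed.

Lemma omega_detB b : inB b -> omega (\det b) * omega (b 0 0) ^+ q = omega (b 0 0).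
Proof.
move=> hb; have [b0 b11] := inB_diag hb.
have cb0 : cj (b 0 0) != 0 by rewrite fmorph_eq0.
rewrite det2 (inB_10 hb) mulr0 subr0 b11 -omega_cj // -omegaM //.
  by rewrite divfK.
by rewrite mulf_neq0 ?invr_neq0.
Qed.

(** omega o det is omega^(1-q) on the torus, and its q-th power is omega^(q-q^2) = omega^(q-1);
    hence the exponent q m, reduced modulo q + 1. *)
Lemma detB_tchar m b : inB b ->
  omega (\det b) ^+ ((q * m) %% q.+1) = tchar 1 ((q - 1) * m) (b 0 0).
Proof.
move=> hb; have [b0 _] := inB_diag hb.
rewrite expr_mod ?omega_det_order ?inB_G // /tchar /Defs.mu exp1rz mul1r.
rewrite !exprM; congr (_ ^+ m); set w := omega (b 0 0).
have w0 : w != 0 by rewrite omega_neq0.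
have := omega_detB hb; rewrite -/w; set d := omega _ => e.
have q1 := q_gt1 D.
have hw : w ^+ (q * q) = w.
  have qq : (q * q = ((q ^ 2).-1).+1)%N by rewrite mulnn prednK // expn_gt0; lia.
  by rewrite qq exprS omega_order // mulr1.
have := congr1 (fun x => x ^+ q) e; rewrite exprMn -exprM hw => e'.
apply: (mulIf w0); rewrite e' -exprSr; congr (_ ^+ _); lia.
Qed.

End Characters.

(** * Stable subspaces of induced representations *)

Section StableSubspaces.
Variables (p q : nat) (E : fieldType) (C : closedFieldType) (D : LFData p q E C).
Local Notation cj := (cj D).
Local Notation bd := (val_ge D).
Local Notation inG := (inG D).
Local Notation inB := (inB D).
Local Notation s := (smx E).

Variable X : E -> C.
Hypotheses (XM : forall a b : E, a != 0 -> b != 0 -> X (a * b) = X a * X b)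
  (X0 : forall a : E, a != 0 -> X a != 0)
  (X_near1 : forall a, bd 1 (a - 1) -> X a = 1).
Local Notation I := (IndSpace D (fun b => X (b 0 0))).

Lemma ind_rt_s j : I (rt s (phi D X j)) /\ rt s (phi D X j) 1 = 1.
Proof.
split; last by rewrite /rt mx_1m phi_s.
by apply: ind_rt (inGs D) _; exact: phi_ind.
Qed.

Lemma ind_rtB f b : I f -> inB b -> rt b f 1 = X (b 0 0) * f 1.
Proof. by move=> hf hb; rewrite /rt mx_1m (ind_B hf hb). Qed.

(** A P meeting W contains W, hence also the s-translate of [phi], whose value 1 at 1 completes W to
    the whole space. Otherwise evaluation at 1 is injective on P. *)
Lemma ind_stable (P : Fun E C -> Prop) :
  FSubspace P -> (forall f, P f -> I f) ->
  (forall h f, inG h -> P f -> P (rt h f)) ->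
  [\/ forall f, I f -> P f, forall f, P f -> f = (fun=> 0) |
      exists f1, [/\ P f1, f1 1 = 1,
        forall g h, inG h -> f1 (g *m h) = f1 g * f1 h &
        forall f, P f -> f = fun g => f 1 * f1 g]].
Proof.
move=> Psub PI Prt; have [P0 Pl] := Psub.
have [[f0 [Pf0 f01 f0n]]|h] := pselect (exists f0, [/\ P f0, f0 1 = 0 & f0 <> (fun=> 0)]).
  constructor 1 => f If.
  have PW f' : I f' -> f' 1 = 0 -> P f'.
    apply: (@ind_borel_irreducible _ _ _ _ _ _ XM X0 X_near1 P f0) => //.
      by move=> b f'' hb; apply: Prt; exact: inB_G.
    exact: PI.
  have [If2 f21] := ind_rt_s 0.
  have Pf2 : P (rt s (phi D X 0)).
    by apply: Prt (inGs D) _; apply: PW; [exact: phi_ind | exact: phi_1].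
  have -> : f = lcomb (f 1) (rt s (phi D X 0)) (lcomb (- f 1) (rt s (phi D X 0)) f).
    by apply/funext => g; rewrite /lcomb mulNr addrA subrr add0r.
  apply: Pl => //; apply: PW; first exact: ind_lcomb.
  by rewrite /lcomb f21 mulr1 addNr.
have h' f : P f -> f 1 = 0 -> f = fun=> 0.
  by move=> Pf f1; apply: contrapT => fn; apply: h; exists f.
have [|] := pselect (forall f, P f -> f 1 = 0).
  by move=> all0; constructor 2 => f Pf; apply: h' => //; exact: all0.
move=> /existsNP[f /not_implyP[Pf /eqP fn]]; constructor 3.
pose f1 := lcomb (f 1)^-1 f (fun=> 0).
have f11 : f1 1 = 1 by rewrite /f1 /lcomb addr0 mulVf.
have Pf1 : P f1 by apply: Pl.
have hf1 f' : P f' -> f' = fun g => f' 1 * f1 g.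
  move=> Pf'; have /h' e : P (lcomb (- f' 1) f1 f') by apply: Pl.
  apply/funext => g; apply/eqP; rewrite -subr_eq0 addrC -mulNr; apply/eqP.
  have := congr1 (fun F => F g) (e _); rewrite /lcomb => -> //.
  by rewrite f11 mulr1 addNr.
(* [rt k f1] is a multiple of f1, and evaluation at 1 shows the factor to be f1 k. *)
exists f1; split=> // g k hk.
have := congr1 (fun F => F g) (hf1 _ (Prt _ _ hk Pf1)).
by rewrite /rt mx_1m mulrC.
Qed.

(* [nmat b *m nbar (- b^-1) *m nmat b = tmat b *m s], and a character is trivial
   on the first three factors because [nbar c] is conjugate to [nmat c] by the involution [s]. *)
Lemma ind_character_s f1 b : I f1 -> f1 1 = 1 ->
  (forall g h, inG g -> inG h -> f1 (g *m h) = f1 g * f1 h) ->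
  cj b = - b -> b != 0 -> X b * f1 s = 1.
Proof.
move=> If1 f11 f1M cb b0.
have f1n y : cj y = - y -> f1 (nmat y) = 1.
  by move=> cy; rewrite (ind_B If1 (inB_n cy)) mx2E (X_1 X_near1) mul1r.
have f1ss : f1 s * f1 s = 1 by rewrite -f1M ?inGs // ss1.
have ci : cj (- b^-1) = - (- b^-1).
  by rewrite rmorphN fmorphV /= cb invrN.
have f1nb y : cj y = - y -> f1 (nbar y) = 1.
  move=> cy; have -> : nbar y = s *m nmat y *m s.
    by apply: mx2P; rewrite !mulE !smxE !mx2E ?mulr0 ?mul0r ?mulr1 ?mul1r ?add0r ?addr0.
  by rewrite !f1M ?inGM ?inGs ?inG_n ?cy // f1n // mulr1.
have e : tmat D b *m s = nmat b *m nbar (- b^-1) *m nmat b.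
  apply: mx2P; rewrite !mulE !smxE !mx2E ?mulr0 ?mul0r ?mulr1 ?mul1r ?add0r ?addr0 ?cb.
  - by rewrite mulrN divff // subrr.
  - by rewrite mulrN divff // subrr mul0r add0r.
  - by rewrite invrN.
  - by rewrite mulNr mulVf // addNr.
have ht := inB_t D b0.
have -> : X b = f1 (tmat D b) by rewrite (ind_B If1 ht) mx2E f11 mulr1.
rewrite -f1M ?inGs // ?(inB_G ht) // e.
by rewrite !f1M ?inGM ?inG_n ?inG_nbar ?cb // f1n // f1nb // !mulr1.
Qed.

(** [ind_character_s] at a skew unit determines the value at s, and multiplicativity spreads it over
    the big cell. *)
Lemma ind_character_eq f1 f2 :
  I f1 -> f1 1 = 1 -> (forall g h, inG g -> inG h -> f1 (g *m h) = f1 g * f1 h) ->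
  I f2 -> f2 1 = 1 -> (forall g h, inG g -> inG h -> f2 (g *m h) = f2 g * f2 h) ->
  f1 = f2.
Proof.
move=> I1 e1 M1 I2 e2 M2; have [u [u0 vu cu]] := exists_skew_unit D.
have es : f1 s = f2 s.
  apply: (mulfI (X0 u0)); rewrite (ind_character_s I1 e1 M1 cu u0).
  by rewrite (ind_character_s I2 e2 M2 cu u0).
apply: (ind_ext I1 I2); first by rewrite e1 e2.
move=> x cx; rewrite /sn M1 ?M2 ?inGs ?inG_n ?cx // es.
by rewrite (ind_B I1 (inB_n cx)) (ind_B I2 (inB_n cx)) e1 e2.
Qed.

End StableSubspaces.

(** * Inducing characters whose induced space contains a character of G *)

Section Exceptional.
Variables (p q : nat) (E : fieldType) (C : closedFieldType) (D : LFData p q E C).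
Local Notation inG := (inG D).
Local Notation cj := (cj D).

(** Dividing the relation of [ind_character_s] at u b by the one at u, for b in F^x, gives X b = 1.
    At [unif] this is lam = 1; at the norm of a residue generator it says that q^2 - 1 divides (q +
    1) r. *)
Lemma ind_character_exceptional lam r f1 : lam != 0 ->
  IndSpace D (fun b => tchar D lam r (b 0 0)) f1 -> f1 1 = 1 ->
  (forall g h, inG g -> inG h -> f1 (g *m h) = f1 g * f1 h) ->
  lam = 1 /\ exists m, r = ((q - 1) * m)%N.
Proof.
move=> l0 If1 f11 f1M; have [u [u0 vu cu]] := exists_skew_unit D.
have XM := tcharM D r l0; have X0 := tchar_neq0 D r l0.
have key b : cj b = b -> b != 0 -> tchar D lam r b = 1.
  move=> cb b0; have ub0 : u * b != 0 by rewrite mulf_neq0.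
  have cub : cj (u * b) = - (u * b) by rewrite rmorphM /= cu cb mulNr.
  have e1 := ind_character_s (@tchar_near1 _ _ _ _ D lam r) If1 f11 f1M cu u0.
  have e2 := ind_character_s (@tchar_near1 _ _ _ _ D lam r) If1 f11 f1M cub ub0.
  move: e2; rewrite XM // mulrAC e1 mul1r //.
split; first by rewrite -(tchar_unif D lam r) key ?unif_cj ?unif_neq0.
have [z [z0 vz pz _]] := residue_gen D.
have cz0 : cj z != 0 by rewrite fmorph_eq0.
have := key (z * cj z); rewrite rmorphM /= cj_invol mulrC mulf_neq0 // => /(_ erefl isT).
rewrite tchar_unit ?v_mul // ?v_cj' ?vz // redM ?bd_cj ?bd_unit // red_cj ?bd_unit //.
rewrite -exprS -exprM => /eqP; rewrite -(prim_order_dvd pz).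
have q1 := q_gt1 D.
have -> : ((q ^ 2).-1 = q.+1 * (q - 1))%N by nia.
rewrite dvdn_pmul2l // => /dvdnP[m ->]; exists m; exact: mulnC.
Qed.

End Exceptional.

(** * Classification *)

Section Classification.
Variables (p q : nat) (E : fieldType) (C : closedFieldType) (D : LFData p q E C).
Variables (V : lmodType C) (rho : 'M[E]_2 -> V -> V).
Hypothesis (rho_smooth : IsSmoothRep D rho).
Local Notation v := (v D).
Local Notation unif := (unif D).
Local Notation cj := (cj D).
Local Notation red := (red D).
Local Notation bd := (val_ge D).
Local Notation trace0 := (trace_zero D).
Local Notation omega := (omega D).
Local Notation inG := (inG D).
Local Notation inB := (inB D).
Local Notation s := (smx E).
Local Notation tmat := (tmat D).
Local Notation detc := (det_char D).
Local Notation Ind X := (IndSpace D (fun b => X (b 0 0))).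
Local Notation tchar := (tchar D).

Lemma rhoD g a x y : inG g -> rho g (a *: x + y) = a *: rho g x + rho g y.
Proof. by move=> hg; case: rho_smooth => h _ _ _; exact: h. Qed.

Lemma rho0 g : inG g -> rho g 0 = 0.
Proof.
move=> hg; have := rhoD (-1) 0 0 hg.
by rewrite scaler0 addr0 scaleN1r addNr.
Qed.

Lemma rhoZ g a x : inG g -> rho g (a *: x) = a *: rho g x.
Proof. by move=> hg; have := rhoD a x 0 hg; rewrite addr0 rho0 // addr0. Qed.

Lemma IndSpace_eqB chi chi' f : (forall b, inB b -> chi b = chi' b) ->
  IndSpace D chi f -> IndSpace D chi' f.
Proof. by move=> e [f1 f2 f3]; split=> // b g hb hg; rewrite -e // f2. Qed.

(** Where X is the restriction of omega^k o det, division by this character untwists Ind X to Ind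
    1. *)
Lemma detcV_mul k X f : (forall b, inB b -> omega (\det b) ^+ k = X (b 0 0)) ->
  Ind X f -> IndSpace D (fun _ => 1) (fun g => (detc k g)^-1 * f g).
Proof.
move=> e [f1 f2 [n f3]]; split.
- by move=> g hg; rewrite f1 // mulr0.
- move=> b g hb hg; rewrite mul1r f2 // -e // -(detcE _ (inB_G hb)).
  rewrite (detcM _ (inB_G hb) hg) invfM mulrACA mulVf ?mul1r //.
  exact: detc_neq0 (inB_G hb).
exists (maxn 1 n) => g k' hg hk; have [kG _] := inKP _ _ _ hk.
rewrite f3 //; last by apply: inK_le hk; rewrite leq_maxr.
rewrite (detcM _ hg kG) (@detc_K _ _ _ _ _ k k') ?mulr1 //.
by apply: inK_le hk; rewrite leq_maxl.
Qed.

Lemma detc_mul k X f : (forall b, inB b -> omega (\det b) ^+ k = X (b 0 0)) ->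
  IndSpace D (fun _ => 1) f -> Ind X (fun g => detc k g * f g).
Proof.
move=> e [f1 f2 [n f3]]; split.
- by move=> g hg; rewrite f1 // mulr0.
- move=> b g hb hg; rewrite f2 // -e // -(detcE _ (inB_G hb)).
  by rewrite (detcM _ (inB_G hb) hg) mul1r mulrA.
exists (maxn 1 n) => g k' hg hk; have [kG _] := inKP _ _ _ hk.
rewrite f3 //; last by apply: inK_le hk; rewrite leq_maxr.
rewrite (detcM _ hg kG) (@detc_K _ _ _ _ _ k k') ?mulr1 //.
by apply: inK_le hk; rewrite leq_maxl.
Qed.

(** [ind_stable] is applied to P and then to the kernel K of F. The whole space with K = 0 gives a
    principal series, the whole space with K a line gives a twist of Steinberg, and P a line gives a
    character. *)
Lemma exists_param lam r : lam != 0 -> (r < q ^ 2 - 1)%N -> Irreducible D rho ->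
  SubquotInd D rho (fun b => tchar lam r (b 0 0)) ->
  exists prm : Param C, ValidParam q prm /\ IsoParam D rho prm.
Proof.
move=> l0 hr [[x0 x00] irr] [P [F [[PI Psub Prt] [Fl Frt Fsurj]]]].
have XM := tcharM D r l0; have X0 := tchar_neq0 D r l0.
have Xn := @tchar_near1 _ _ _ _ D lam r.
have [P0 Pl] := Psub.
have F0 : F (fun=> 0) = 0.
  by have := Fl (-1) _ _ P0 P0; rewrite lcomb0 scaleN1r addNr.
have FZ a f : P f -> F (fun g => a * f g) = a *: F f.
  by move=> Pf; rewrite -lcombZ Fl // F0 addr0.
have q1 := q_gt1 D.
have exceptional f1 : Ind (tchar lam r) f1 -> f1 1 = 1 ->
    (forall g h, inG h -> f1 (g *m h) = f1 g * f1 h) ->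
  exists k, [/\ (k < q.+1)%N, f1 = detc k &
    forall b, inB b -> omega (\det b) ^+ k = tchar lam r (b 0 0)].
  move=> If1 f11 f1M.
  have f1M' g h : inG g -> inG h -> f1 (g *m h) = f1 g * f1 h by move=> _; exact: f1M.
  have [l1 [m rE]] := ind_character_exceptional l0 If1 f11 f1M'.
  have e b : inB b -> omega (\det b) ^+ ((q * m) %% q.+1) = tchar lam r (b 0 0).
    by rewrite l1 rE; exact: detB_tchar.
  exists ((q * m) %% q.+1)%N; split=> //; first by rewrite ltn_mod.
  apply: (ind_character_eq X0 Xn If1 f11 f1M') => //.
  - exact: detc_ind.
  - exact: detc_1.
  - by move=> g h; exact: detcM.
pose K f := P f /\ F f = 0.
have Ksub : FSubspace K.
  split=> [//|a f h [Pf f0] [Ph h0]]; split; first exact: Pl.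
  by rewrite Fl // f0 h0 scaler0 addr0.
have Krt h f : inG h -> K f -> K (rt h f).
  by move=> hh [Pf f0]; split; [exact: Prt | rewrite Frt // f0 rho0].
have [f2 [Pf2 Ff2]] := Fsurj x0.
case: (ind_stable XM X0 Xn Psub PI Prt) => [Pall|Pz|[f1 [Pf1 f11 f1M hf1]]].
- have KI f : K f -> Ind (tchar lam r) f by case=> /PI.
  case: (ind_stable XM X0 Xn Ksub KI Krt) => [Kall|Kz|[f1 [[Pf1 Ff1] f11 f1M hf1]]].
  + by have [_ f20] := Kall _ (PI _ Pf2); move: x00; rewrite -Ff2 f20 eqxx.
  + have Finj f f' : P f -> P f' -> F f = F f' -> f = f'.
      move=> Pf Pf' e; have /Kz h : K (lcomb (-1) f' f).
        by split; [exact: Pl | rewrite Fl // e scaleN1r addNr].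
      apply/funext => g; apply/eqP; rewrite -subr_eq0.
      by have := congr1 (fun F => F g) h; rewrite lcombB => ->.
    exists (PPS lam r); split; last first.
      exists F; split.
      * by move=> a f f' If If'; apply: Fl; exact: Pall.
      * by move=> f f' If If'; apply: Finj; exact: Pall.
      * by move=> x; have [f [Pf e]] := Fsurj x; exists f; split=> //; exact: PI.
      * by move=> h f hh If; apply: Frt => //; exact: Pall.
    (* For exceptional parameters the induced space contains [detc k]. By irreducibility its image
       would span V, and by injectivity of F the function [phi] would be a multiple of [detc k]; the
       values at 1 and s exclude this. *)
    split=> // -[m [rE l1]].
    have [m' rE'] : exists m', r = ((q - 1) * m')%N by exists `|m|%N; nia.
    have e b : inB b -> omega (\det b) ^+ ((q * m') %% q.+1) = tchar lam r (b 0 0).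
      by rewrite l1 rE'; exact: detB_tchar.
    set k := ((q * m') %% q.+1)%N in e.
    have Pd : P (detc k) by apply/Pall/detc_ind.
    have rtd g : inG g -> rt g (detc k) = fun h => detc k g * detc k h.
      move=> hg; apply/funext => h; rewrite /rt mulrC.
      have [hh|hh] := boolP (inG h); first by rewrite detcM.
      by rewrite /det_char inG_mulr // (negPf hh) mul0r.
    have [||L0|Lall] := irr (fun x => exists c, x = c *: F (detc k)).
    * split; first by exists 0; rewrite scale0r.
      by move=> a x y [c ->] [c' ->]; exists (a * c + c'); rewrite scalerDl scalerA.
    * move=> g x hg [c ->]; exists (c * detc k g); rewrite rhoZ //.
      by rewrite -Frt // rtd // FZ // scalerA.
    * have : K (detc k) by split=> //; apply: L0; exists 1; rewrite scale1r.
      move=> /Kz/(congr1 (fun F => F 1)); rewrite detc_1 => /eqP.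
      by rewrite oner_eq0.
    have Pphi : P (phi D (tchar lam r) 0) by apply/Pall/phi_ind.
    have [c] := Lall (F (phi D (tchar lam r) 0)); rewrite -FZ // => /Finj h.
    have {}h := h Pphi _; rewrite -lcombZ in h.
    have /h{}h : P (lcomb c (detc k) (fun=> 0)) by exact: Pl.
    have := congr1 (fun F => F 1) h; have := congr1 (fun F => F s) h.
    rewrite lcombZ phi_1 detc_1 mulr1 => + c0; rewrite -c0 mul0r phi_s //.
    by move/eqP; rewrite oner_eq0.
  have [k [kq f1E e]] := exceptional f1 (PI _ Pf1) f11 f1M.
  (* K is the line of [detc k], which the twist turns into the constants. *)
  exists (PSt C k); split=> //; exists (fun f => F (fun g => detc k g * f g)).
  have Pm f : IndSpace D (fun=> 1) f -> P (fun g => detc k g * f g).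
    by move=> If; apply/Pall/(detc_mul e).
  split.
  + move=> a f f' If If'; rewrite -Fl; try exact: Pm.
    by congr F; apply/funext => g; rewrite /lcomb mulrDr mulrCA.
  + move=> x; have [f [Pf <-]] := Fsurj x.
    exists (fun g => (detc k g)^-1 * f g); split.
      by apply: (detcV_mul e); exact: PI.
    congr F; apply/funext => g; have [hg|hg] := boolP (inG g).
      by rewrite mulVKf // detc_neq0.
    by have [f0 _ _] := PI _ Pf; rewrite f0 // !mulr0.
  + move=> f If; split=> [Ff|[c fc]].
      exists (f 1) => g hg.
      have /hf1/(congr1 (fun F => F g)) : K (fun g => detc k g * f g) by split=> //; exact: Pm.
      rewrite /= detc_1 mul1r f1E mulrC => /mulIf; apply; exact: detc_neq0.
    have -> : (fun g => detc k g * f g) = fun g => c * f1 g.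
      apply/funext => g; rewrite f1E mulrC; have [hg|hg] := boolP (inG g).
        by rewrite fc.
      by rewrite /det_char (negPf hg) !mulr0.
    by rewrite FZ // Ff1 scaler0.
  + move=> h f hh If; rewrite -Frt //; last exact: Pm.
    rewrite -detcE // -FZ; last by apply: Pm; exact: (@ind_rt _ _ _ _ D (fun=> 1)).
    congr F; apply/funext => g; rewrite /rt; have [hg|hg] := boolP (inG g).
      by rewrite detcM // mulrA [detc k h * _]mulrC.
    by rewrite /det_char (inG_mulr _ hh) (negPf hg) !mul0r mulr0.
- by move: x00; rewrite -Ff2 (Pz _ Pf2) F0 eqxx.
have [k [kq f1E e]] := exceptional f1 (PI _ Pf1) f11 f1M.
have span x : exists c : C, x = c *: F f1.
  by have [f [Pf <-]] := Fsurj x; exists (f 1); rewrite -FZ // -hf1.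
exists (PChar C k); split=> //; exists (F f1); split=> //.
  apply: contra_neq x00 => z; have [c ->] := span x0.
  by rewrite z scaler0.
move=> g hg; rewrite -Frt // -detcE // -f1E -FZ //; congr F.
by apply/funext => h; rewrite /rt f1M // mulrC.
Qed.

(* [F] identifies the twist of a quotient of [Ind X] by [omega^k o det] with [V];
   this covers the principal series ([k = 0]) and the twists of Steinberg ([X = 1]). *)
Definition model (X : E -> C) (k : nat) (F : Fun E C -> V) : Prop :=
  [/\ forall a f f', Ind X f -> Ind X f' -> F (lcomb a f f') = a *: F f + F f',
      forall x, exists f, Ind X f /\ F f = x &
      forall h f, inG h -> Ind X f -> detc k h *: F (rt h f) = rho h (F f)].

Lemma detc_0 g : inG g -> detc 0 g = 1.
Proof. by move=> hg; rewrite detcE // expr0. Qed.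

Lemma model_ind lam r : IsoParam D rho (PPS lam r) -> exists F,
  model (tchar lam r) 0 F /\
  forall f f', Ind (tchar lam r) f -> Ind (tchar lam r) f' -> F f = F f' -> f = f'.
Proof.
move=> [F [Fl Finj Fsurj Frt]]; exists F; split=> //; split=> // h f hh If.
by rewrite detc_0 // scale1r Frt.
Qed.

Lemma model_St k : IsoParam D rho (PSt C k) -> exists F,
  model (fun=> 1) k F /\ forall f, IndSpace D (fun=> 1) f ->
           (F f = 0 <-> exists c : C, forall g, inG g -> f g = c).
Proof.
move=> [F [Fl Fsurj Fker Frt]]; exists F; split=> //; split=> // h f hh If.
by rewrite detcE // Frt.
Qed.

(** * Comparison of two models of one representation *)

Section Model.
Variables (X : E -> C) (k : nat) (F : Fun E C -> V).
Hypotheses (XM : forall a b : E, a != 0 -> b != 0 -> X (a * b) = X a * X b)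
  (X0 : forall a : E, a != 0 -> X a != 0)
  (X_near1 : forall a, bd 1 (a - 1) -> X a = 1) (mF : model X k F).

Lemma model_0 : F (fun=> 0) = 0.
Proof.
have [Fl _ _] := mF; have I0 := ind_0 D X.
by have := Fl (-1) _ _ I0 I0; rewrite lcomb0 scaleN1r addNr.
Qed.

Lemma model_n f y : Ind X f -> cj y = - y ->
  F (lcomb (-1) f (rt (nmat y) f)) = rho (nmat y) (F f) - F f.
Proof.
have [Fl _ Frt] := mF => If cy; have yG := inB_G (inB_n cy).
rewrite Fl //; last exact: ind_rt.
by rewrite -Frt // detc_n // scale1r scaleN1r addrC.
Qed.

Lemma model_decomp f f2 : Ind X f -> Ind X f2 -> f2 1 = 1 ->
  Ind X (lcomb (- f 1) f2 f) /\ lcomb (- f 1) f2 f 1 = 0.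
Proof.
move=> If If2 f21; split; first exact: ind_lcomb.
by rewrite /lcomb f21 mulr1 addNr.
Qed.

Lemma exists_far : exists y, cj y = - y /\ trace0 0 y = false.
Proof.
have [u [u0 vu cu]] := exists_skew_unit D.
have y0 : u * unif ^ (-1) != 0 by rewrite mulf_neq0 ?unifX_neq0.
exists (u * unif ^ (-1)); split.
  by rewrite rmorphM fmorphXz /= unif_cj cu mulNr.
apply: contraTF isT => /andP[_]; rewrite bd_neq0 // v_mul ?unifX_neq0 //.
by rewrite vu v_unifX.
Qed.

(** A vector n w - w that is nonzero: [nmat y] moves the support of [phi] off s. *)
Lemma phi_moved y : cj y = - y -> trace0 0 y = false ->
  let f := lcomb (-1) (phi D X 0) (rt (nmat y) (phi D X 0)) in
  [/\ Ind X f, f 1 = 0 & f s = -1].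
Proof.
move=> cy hy /=; have Ip := phi_ind XM X0 X_near1 0; split.
- by apply: ind_lcomb => //; apply: ind_rt => //; exact: inB_G (inB_n cy).
- rewrite lcombB phi_1 subr0 (ind_rtB Ip (inB_n cy)) phi_1 mulr0 //.
- rewrite lcombB phi_s // /rt (_ : s *m nmat y = sn y) // phi_sn // hy.
  by rewrite sub0r.
Qed.

(** W is generated under B by a vector n w - w. In the second model it becomes n g - g, which
    vanishes at 1 because N acts trivially there. *)
Lemma model_subset X' F' :
  (forall a, bd 1 (a - 1) -> X' a = 1) -> model X' 0 F' ->
  forall f, Ind X f -> f 1 = 0 -> exists f', [/\ Ind X' f', f' 1 = 0 & F f = F' f'].
Proof.
move=> X'1 mF' f If f1.
have [Fl Fs Frt] := mF; have [Fl' Fs' Frt'] := mF'.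
have I0' := ind_0 D X'.
have F0' : F' (fun=> 0) = 0.
  by have := Fl' (-1) _ _ I0' I0'; rewrite lcomb0 scaleN1r addNr.
pose Q f := Ind X f /\ exists f', [/\ Ind X' f', f' 1 = 0 & F f = F' f'].
have [y [cy hy]] := exists_far.
have [] := phi_moved cy hy; set f0 := lcomb _ _ _ => If0 f01 f0s.
have Ip := phi_ind XM X0 X_near1 0.
suff : Q f by case.
apply: (@ind_borel_irreducible _ _ _ _ _ _ XM X0 X_near1 Q f0) => //.
- split; first by split; [exact: ind_0 | exists (fun=> 0); rewrite model_0 F0'].
  move=> a g h [Ig [g' [Ig' g1 eg]]] [Ih [h' [Ih' h1 eh]]].
  split; first exact: ind_lcomb.
  exists (lcomb a g' h'); split; first exact: ind_lcomb.
    by rewrite /lcomb g1 h1 mulr0 addr0.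
  by rewrite Fl // Fl' // eg eh.
- move=> b g hb [Ig [g' [Ig' g1 eg]]]; have bG := inB_G hb.
  have Irb : Ind X' (rt b g') by exact: ind_rt.
  split; first exact: ind_rt.
  (* The scalar compensates the twist, which only the first model carries. *)
  exists (fun h => (detc k b)^-1 * rt b g' h); split.
  + by rewrite -lcombZ; apply: ind_lcomb => //; exact: ind_0.
  + by rewrite (ind_rtB Ig' hb) g1 !mulr0.
  + have d0 := @detc_neq0 _ _ _ _ D k _ bG.
    rewrite -lcombZ Fl' // F0' addr0; apply: (scalerI d0).
    by rewrite Frt // scalerA divff // scale1r eg -Frt' // detc_0 // scale1r.
- split=> //; have [g0 [Ig0 e0]] := Fs' (F (phi D X 0)).
  have yG := inB_G (inB_n cy); have Irg := ind_rt yG Ig0.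
  exists (lcomb (-1) g0 (rt (nmat y) g0)); split; first exact: ind_lcomb.
    by rewrite lcombB (ind_rtB Ig0 (inB_n cy)) mx2E (X_1 X'1) mul1r subrr.
  rewrite model_n // Fl' // e0 scaleN1r addrC -e0 -Frt' // detc_0 // scale1r.
  by [].
- by move=> z; move: f0s; rewrite z => /eqP; rewrite eq_sym oppr_eq0 oner_eq0.
Qed.

End Model.

(** Modulo constants every element of Ind 1 lies in W, so V = F(W) would lie in F'(W'); but W' is a
    proper subspace and F' is injective. *)
Lemma St_not_PS k lam r : lam != 0 -> IsoParam D rho (PSt C k) ->
  IsoParam D rho (PPS lam r) -> False.
Proof.
move=> l0 /model_St[F [mF kerF]] /model_ind[F' [mF' injF']].
have X'M := tcharM D r l0; have X'0 := tchar_neq0 D r l0.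
have X'1 := @tchar_near1 _ _ _ _ D lam r.
have XM : forall a b : E, a != 0 -> b != 0 -> (fun=> 1 : C) (a * b) = (fun=> 1) a * (fun=> 1) b.
  by move=> *; rewrite mul1r.
have X0 : forall a : E, a != 0 -> (fun=> 1 : C) a != 0 by move=> *; exact: oner_neq0.
have X1 : forall a : E, bd 1 (a - 1) -> (fun=> 1 : C) a = 1 by [].
have [Fl Fs Frt] := mF.
have I1 : Ind (fun=> 1) (detc 0) by apply: (@detc_ind _ _ _ _ D 0 (fun=> 1)) => b _; rewrite expr0.
have [Ig g1] := ind_rt_s X'M X'0 X'1 0; set g := rt _ _ in Ig g1.
have [f [If Ff]] := Fs (F' g).
have [Iw w1] := @model_decomp (fun=> 1) _ _ If I1 (detc_1 D 0).
have [w' [Iw' w'1 ew]] := model_subset XM X0 X1 mF X'1 mF' Iw w1.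
have : F (lcomb (- f 1) (detc 0) f) = F f.
  rewrite Fl // (_ : F (detc 0) = 0) ?scaler0 ?add0r //.
  by apply/kerF => //; exists 1; exact: detc_0.
rewrite ew Ff => /injF' e; move: g1; rewrite -e // w'1 => /eqP.
by rewrite eq_sym oner_eq0.
Qed.

(** The torus acts on Ind X modulo W through X. As W is carried into W', both characters describe
    its action on the vector g modulo W'. *)
Lemma PS_inj lam r lam' r' : lam != 0 -> lam' != 0 ->
  (r < q ^ 2 - 1)%N -> (r' < q ^ 2 - 1)%N ->
  IsoParam D rho (PPS lam r) -> IsoParam D rho (PPS lam' r') -> lam = lam' /\ r = r'.
Proof.
move=> l0 l0' hr hr' /model_ind[F [mF injF]] /model_ind[F' [mF' injF']].
have XM := tcharM D r l0; have X0 := tchar_neq0 D r l0.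
have X1 := @tchar_near1 _ _ _ _ D lam r.
have X'M := tcharM D r' l0'; have X'0 := tchar_neq0 D r' l0'.
have X'1 := @tchar_near1 _ _ _ _ D lam' r'.
have [Fl Fs Frt] := mF; have [Fl' Fs' Frt'] := mF'.
have [If f1] := ind_rt_s XM X0 X1 0; set f := rt _ _ in If f1.
have [Ig' g'1] := ind_rt_s X'M X'0 X'1 0; set g' := rt _ _ in Ig' g'1.
have [g [Ig eg]] := Fs' (F f).
have sub := model_subset XM X0 X1 mF X'1 mF'.
(* Otherwise all of V, being spanned by F f and F(W), would lie in F'(W'). *)
have g1 : g 1 != 0.
  apply/eqP => g1; have [h [Ih eh]] := Fs (F' g').
  have [Iw w1] := model_decomp Ih If f1.
  have [w' [Iw' w'1 ew]] := sub _ Iw w1.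
  have e : F' (lcomb (h 1) g w') = F' g'.
    rewrite Fl' // eg -ew -eh Fl // addrA -scalerDl.
    by rewrite addrN scale0r add0r.
  have := injF' _ _ _ Ig' e; move=> /(_ (ind_lcomb _ Ig Iw')) {}e.
  by move: g'1; rewrite -e /lcomb g1 w'1 mulr0 addr0 => /eqP; rewrite eq_sym oner_eq0.
apply: (@tchar_inj _ _ _ _ D) => // a a0; have hb := inB_t D a0; have bG := inB_G hb.
have Irf := ind_rt bG If; have Irg := ind_rt bG Ig.
have Iw : Ind (tchar lam r) (lcomb (- tchar lam r a) f (rt (tmat a) f)).
  exact: ind_lcomb.
have w1 : lcomb (- tchar lam r a) f (rt (tmat a) f) 1 = 0.
  by rewrite /lcomb (ind_rtB If hb) mx2E f1 !mulr1 addNr.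
have [w' [Iw' w'1 ew]] := sub _ Iw w1.
have : F' (lcomb (- tchar lam r a) g (rt (tmat a) g)) = F' w'.
  rewrite -ew Fl // Fl' // eg; congr (_ + _).
  have := Frt _ _ bG If; have := Frt' _ _ bG Ig; rewrite detc_0 // !scale1r => -> ->.
  by rewrite eg.
move/injF' => /(_ (ind_lcomb _ Ig Irg) Iw')/(congr1 (fun F => F 1)).
rewrite w'1 /lcomb (ind_rtB Ig hb) mx2E mulNr addrC => /subr0_eq /(mulIf g1).
by [].
Qed.

(** N fixes the line, so F kills the vector of [phi_moved], whose values at 1 and s differ. The
    kernel hypothesis serves both for injective F and for the Steinberg quotient. *)
Lemma char_not_model k X F j :
  (forall a b : E, a != 0 -> b != 0 -> X (a * b) = X a * X b) ->
  (forall a : E, a != 0 -> X a != 0) ->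
  (forall a, bd 1 (a - 1) -> X a = 1) -> model X j F ->
  (forall f, Ind X f -> F f = 0 -> exists c : C, forall g, inG g -> f g = c) ->
  IsoParam D rho (PChar C k) -> False.
Proof.
move=> XM X0 X1 mF kerF [x [x0 span rx]].
have [y [cy hy]] := exists_far.
have [If0 f01 f0s] := phi_moved XM X0 X1 cy hy.
have yG := inB_G (inB_n cy).
have : F (lcomb (-1) (phi D X 0) (rt (nmat y) (phi D X 0))) = 0.
  rewrite (model_n mF) //; last exact: phi_ind.
  have [c ->] := span (F (phi D X 0)).
  by rewrite rhoZ // rx // -detcE // detc_n // scale1r subrr.
move=> /(kerF _ If0)[c hc]; have := hc 1 (inG1 D); rewrite f01 => c0.
have := hc s (inGs D); rewrite f0s -c0 => /eqP.
by rewrite oppr_eq0 oner_eq0.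
Qed.

(** For a residue generator the determinant reduces to zeta^(1-q), of order q + 1. The equality of
    powers is rewritten as zeta^(k + q k') = zeta^(k' + q k) to keep exponents nonnegative. *)
Lemma detc_inj k k' : (k < q.+1)%N -> (k' < q.+1)%N ->
  (forall z, z != 0 -> v z = 0 -> detc k (tmat z) = detc k' (tmat z)) -> k = k'.
Proof.
have [z [z0 vz pz _]] := residue_gen D.
wlog kk : k k' / (k <= k')%N.
  move=> W hk hk' h; case: (leqP k k') => [le|/ltnW le]; first exact: W.
  by apply/esym/W => // w w0 vw; rewrite h.
move=> hk hk' /(_ z z0 vz).
have hb := inB_t D z0; rewrite !detcE ?(inB_G hb) //.
have := omega_detB hb; rewrite mx2E (omega_red vz); set d := omega _ => ed e.
have rz0 := red_neq0 z0 vz.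
have hd n : red z ^+ n = d ^+ n * red z ^+ (q * n) by rewrite -{1}ed exprMn -exprM.
have e1 : red z ^+ (k + q * k') = red z ^+ (k' + q * k).
  by rewrite !exprD (hd k) (hd k') e mulrAC.
have q1 := q_gt1 D.
move/eqP: e1; rewrite (eq_prim_root_expr pz) eqn_mod_dvd; last by nia.
have -> : (k + q * k' - (k' + q * k) = (k' - k) * (q - 1))%N by nia.
have -> : ((q ^ 2).-1 = q.+1 * (q - 1))%N by nia.
rewrite dvdn_pmul2r ?subn_gt0 // => h.
apply/eqP; rewrite eqn_leq kk /= -subn_eq0; apply: contraTT h => h.
by rewrite gtnNdvd ?lt0n //; lia.
Qed.

Lemma char_inj k k' : (k < q.+1)%N -> (k' < q.+1)%N ->
  IsoParam D rho (PChar C k) -> IsoParam D rho (PChar C k') -> k = k'.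
Proof.
move=> hk hk' [x [x0 _ hx]] [x' [x'0 span' hx']].
apply: detc_inj => // z z0 _; have tG := inB_G (inB_t D z0).
have [c xE] := span' x; have := hx _ tG; rewrite {1}xE rhoZ // hx' //.
rewrite scalerA mulrC -scalerA -xE -!detcE // => /eqP.
by rewrite -subr_eq0 -scalerBl scaler_eq0 (negPf x0) orbF subr_eq0 eq_sym => /eqP.
Qed.

(** * Vectors of the Steinberg representation fixed by the pro-p Iwahori subgroup *)

Section Steinberg.
Let X : E -> C := fun=> 1.
Let XM : forall a b : E, a != 0 -> b != 0 -> X (a * b) = X a * X b.
Proof. by move=> *; rewrite mul1r. Qed.
Let X0 : forall a : E, a != 0 -> X a != 0.
Proof. by move=> *; exact: oner_neq0. Qed.
Let X1 : forall a : E, bd 1 (a - 1) -> X a = 1.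
Proof. by []. Qed.
Let f0 := phi D X 0.

Lemma phi_fixed_n y : trace0 0 y -> rt (nmat y) f0 = f0.
Proof.
move=> hy; have [/eqP cy _] := andP hy; have yB := inB_n cy.
have If0 : Ind X f0 by exact: phi_ind.
apply: (ind_ext (ind_rt (inB_G yB) If0) If0).
  by rewrite (ind_rtB If0 yB) mul1r.
move=> x cx; rewrite /rt -snD /f0 !(phi_sn X1); congr (nat_of_bool _)%:R.
apply/idP/idP => h; last exact: trace0D.
by rewrite -[x](addrK y) trace0B.
Qed.

Lemma phi_fixed_nbar y : trace0 1 y -> rt (nbar y) f0 = f0.
Proof.
move=> hy; apply/funext => g.
exact: (@phi_K _ _ _ _ D X XM X1 0 1 g (nbar y) isT isT isT (inK_nbar hy)).
Qed.

(** The norm of a unit preserves every lattice. So units of the torus act on the image of [f0]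
    through the twist alone. *)
Lemma phi_fixed_t z : z != 0 -> v z = 0 -> rt (tmat z) f0 = f0.
Proof.
move=> z0 vz; have tB := inB_t D z0; have cz0 : cj z != 0 by rewrite fmorph_eq0.
have If0 : Ind X f0 by exact: phi_ind.
apply: (ind_ext (ind_rt (inB_G tB) If0) If0).
  by rewrite (ind_rtB If0 tB) mul1r.
move=> x cx; rewrite /rt (ind_sn_t x If0 z0) mul1r /f0 !(phi_sn X1); congr (nat_of_bool _)%:R.
set w := z * cj z; have w0 : w != 0 by rewrite mulf_neq0.
have vw : v w = 0 by rewrite v_mul // v_cj' vz.
have cw : cj w = w by rewrite rmorphM /= cj_invol mulrC.
rewrite /trace_zero rmorphM fmorphV /= cw cx mulNr !eqxx /=.
apply/idP/idP => h.
  by rewrite -[x](divfK w0) mulrC bdM0 // bd_unit.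
by rewrite mulrC bdM0 // bd_unit ?invr_neq0 // vV // vw.
Qed.

(* [G = B (pro-p Iwahori) \cup B s (pro-p Iwahori)]. *)
Lemma iwahori_fixed f : Ind X f ->
  (forall y, trace0 0 y -> f (s *m nmat y) = f s) ->
  (forall y, trace0 1 y -> f (nbar y) = f 1) ->
  f = lcomb (f s - f 1) f0 (fun g => f 1 * detc 0 g).
Proof.
move=> If fn fnb; have If0 : Ind X f0 by exact: phi_ind.
have I1 : Ind X (detc 0) by apply: (@detc_ind _ _ _ _ D 0 (fun=> 1)) => b _; rewrite expr0.
have I1' : Ind X (fun g => f 1 * detc 0 g).
  by rewrite -lcombZ; apply: ind_lcomb => //; exact: ind_0.
apply: (ind_ext If (ind_lcomb _ If0 I1')).
  by rewrite /lcomb /f0 phi_1 mulr0 add0r detc_1 mulr1.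
move=> x cx; have xG : inG (sn x) by rewrite inG_sn cx.
rewrite /lcomb /f0 (phi_sn X1) detc_0 // mulr1.
have [hx|hx] := boolP (trace0 0 x); first by rewrite /sn fn // mulr1 subrK.
rewrite mulr0 add0r; move: hx; rewrite /trace_zero cx eqxx /= => hx.
have x0 : x != 0 by apply: contraNneq hx => ->; rewrite bd0.
have [b bB [_ ->]] := sn_large x0 cx.
have cxi : cj x^-1 = - x^-1 by rewrite fmorphV /= cx invrN.
have [_ f2 _] := If; rewrite f2 ?inG_nbar // mul1r fnb //.
rewrite /trace_zero cxi eqxx /= bd_neq0 ?invr_neq0 // vV //.
move: hx; rewrite bd_neq0 //; lia.
Qed.

(** The vector f that represents F' f0 in the first model is again a multiple of [f0] plus a
    constant, so F' f0 is proportional to F f0 and the torus acts on it by both twists. *)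
Lemma St_inj k k' : (k < q.+1)%N -> (k' < q.+1)%N ->
  IsoParam D rho (PSt C k) -> IsoParam D rho (PSt C k') -> k = k'.
Proof.
move=> hk hk' /model_St[F [mF kerF]] /model_St[F' [mF' kerF']].
have [Fl Fs Frt] := mF; have [Fl' Fs' Frt'] := mF'.
have If0 : Ind X f0 by exact: phi_ind.
have f0s : f0 s = 1 by exact: phi_s.
have F'0 : F' f0 != 0.
  apply/eqP => /(kerF' _ If0)[c hc]; have := hc s (inGs D); have := hc 1 (inG1 D).
  by rewrite f0s /f0 phi_1 => <- /eqP; rewrite oner_eq0.
have [f [If_ eF]] := Fs (F' f0); have If : Ind X f := If_.
have nG y n : trace0 n y -> inG (nmat y) by move=> /andP[cy _]; rewrite inG_n.
have nbG y n : trace0 n y -> inG (nbar y) by move=> /andP[/eqP cy _]; exact: inG_nbar.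
have nb1 j y n : trace0 n y -> detc j (nbar y) = 1.
  move=> hy; rewrite detcE ?(nbG _ _ hy) // det2 !mx2E mul0r subr0 mulr1 omega_1.
  by rewrite expr1n.
(* Invariance in V lifts to f only up to the kernel of F, that is, up to a constant. *)
have fixed h : inG h -> detc k h = 1 -> detc k' h = 1 -> rt h f0 = f0 ->
    exists c : C, forall g, inG g -> f (g *m h) - f g = c.
  move=> hG d d' hf; have Irh := ind_rt hG If.
  have /kerF : IndSpace D (fun=> 1) (lcomb (-1) f (rt h f)) by exact: (ind_lcomb _ If).
  rewrite Fl // scaleN1r; have := Frt _ _ hG If; rewrite d scale1r => ->.
  rewrite eF -Frt' // d' scale1r hf addNr => -[/(_ erefl)[c hc] _].
  by exists c => g gG; rewrite -(hc g gG) lcombB.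
have fE := @iwahori_fixed f If _ _.
have {fE}fE : f = lcomb (f s - f 1) f0 (fun g => f 1 * detc 0 g).
  (* The constant vanishes: it is computed at a point of B\G fixed by the element, namely 1 for
     [nmat y] and s for [nbar y]. *)
  apply: fE => y hy; have [/eqP cy _] := andP hy.
    have [||||c hc] := fixed (nmat y); rewrite ?(nG _ _ hy) ?detc_n ?phi_fixed_n //.
    have := hc 1 (inG1 D); rewrite mx_1m (ind_B If (inB_n cy)) mul1r subrr => c0.
    by have := hc s (inGs D); rewrite -c0 => /subr0_eq.
  have [||||c hc] := fixed (nbar y); rewrite ?(nbG _ _ hy) ?(nb1 _ _ _ hy) ?phi_fixed_nbar //.
  have := hc s (inGs D).
  have -> : s *m nbar y = nmat y *m s.
    by apply: mx2P; rewrite !mulE !smxE !mx2E ?mulr0 ?mul0r ?mulr1 ?mul1r ?add0r ?addr0.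
  have [_ f2 _] := If; rewrite f2 ?inB_n ?inGs // mul1r subrr => c0.
  by have := hc 1 (inG1 D); rewrite mx_1m -c0 => /subr0_eq.
have I1 : Ind X (fun g => f 1 * detc 0 g).
  rewrite -lcombZ; apply: ind_lcomb; last exact: ind_0.
  by apply: (@detc_ind _ _ _ _ D 0 (fun=> 1)) => b _; rewrite expr0.
have F1 : F (fun g => f 1 * detc 0 g) = 0.
  by apply/(kerF _ I1); exists (f 1) => g gG; rewrite detc_0 // mulr1.
have eF' : F' f0 = (f s - f 1) *: F f0 by rewrite -eF {1}fE Fl // F1 addr0.
apply: detc_inj => // z z0 vz; have tG := inB_G (inB_t D z0).
have := Frt' _ _ tG If0; have := Frt _ _ tG If0; rewrite phi_fixed_t // eF' => e.
rewrite rhoZ // -e [RHS]scalerA [_ * detc k _]mulrC -[RHS]scalerA -eF' => /eqP.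
by rewrite -subr_eq0 -scalerBl scaler_eq0 (negPf F'0) orbF subr_eq0 eq_sym => /eqP.
Qed.

End Steinberg.

Lemma param_inj prm prm' : ValidParam q prm -> IsoParam D rho prm ->
  ValidParam q prm' -> IsoParam D rho prm' -> prm = prm'.
Proof.
have St0 k' k : IsoParam D rho (PSt C k) -> IsoParam D rho (PChar C k') -> False.
  move=> /model_St[F [mF kerF]]; apply: (char_not_model _ _ _ mF).
  - by move=> *; rewrite mul1r.
  - by move=> *; exact: oner_neq0.
  - by [].
  - by move=> f If /(kerF _ If).
have PS0 lam r k : lam != 0 -> IsoParam D rho (PPS lam r) ->
    IsoParam D rho (PChar C k) -> False.
  move=> l0 /model_ind[F [mF injF]].
  apply: (char_not_model (tcharM D r l0) (tchar_neq0 D r l0)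
    (@tchar_near1 _ _ _ _ D lam r) mF) => f If Ff.
  exists 0 => g _; have I0 := ind_0 D (tchar lam r).
  by rewrite (injF f _ If I0) // (model_0 mF).
case: prm prm' => [k|k|lam r] [k'|k'|lam' r'] V1 I1 V2 I2.
- by rewrite (char_inj V1 V2 I1 I2).
- by case: (St0 _ _ I2 I1).
- by case: V2 => l0 _ _; case: (PS0 _ _ _ l0 I2 I1).
- by case: (St0 _ _ I1 I2).
- by rewrite (St_inj V1 V2 I1 I2).
- by case: V2 => l0 _ _; case: (St_not_PS l0 I1 I2).
- by case: V1 => l0 _ _; case: (PS0 _ _ _ l0 I1 I2).
- by case: V1 => l0 _ _; case: (St_not_PS l0 I2 I1).
- case: V1 V2 => l0 hr _ [l0' hr' _].
  by have [-> ->] := PS_inj l0 l0' hr hr' I1 I2.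
Qed.

End Classification.

Theorem theorem4p3 (p q : nat) (E : fieldType) (C : closedFieldType)
    (D : LFData p q E C) (V : lmodType C) (rho : 'M[E]_2 -> V -> V) :
  IsSmoothRep D rho -> Irreducible D rho -> ~ Supercuspidal D rho ->
  exists! prm : Param C, ValidParam q prm /\ IsoParam D rho prm.
Proof.
move=> rho_smooth irr /contrapT[chi [chi_char [P [F [[PI Psub Prt] hF]]]]].
have [lam [r [l0 hr chiE]]] := smooth_charB chi_char.
have [|prm [valid iso]] := exists_param rho_smooth l0 hr irr.
  exists P, F; split=> //; split=> // f Pf.
  by apply: (IndSpace_eqB chiE); exact: PI.
exists prm; split=> // prm' [valid' iso'].
exact: (param_inj rho_smooth valid iso valid' iso').
Qed.
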